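(* Suppose that $M_t$, $t\in[0,T)$, is an $n$-dimensional $K$-almost Brakke flow in $\mathbb R^\ell$. Then given $0<\tau,\epsilon_0<\infty$, there exists $\delta>0$ so that if $K<\delta$, then $$\lambda(M_s)<\lambda(M_t)+\epsilon_0$$ for all times $t<s<T$ of the flow with $s-t<\tau$.
   Context: A one-parameter family $\{(t,\mu_t)\mid a<t<b\}$ of Radon measures in an open set $U\subset\mathbb R^\ell$ is a $K$-almost Brakke flow if: (1) for almost every $t$, $\mu_t$ is the Radon measure associated with an integer multiplicity rectifiable varifold; (2) for every nonnegative compactly supported $C^1$ function $\phi$ on $U$, $$\overline D_t\int\phi\,d\mu_t\le\int\big(-\phi|H|^2+\nabla\phi\cdot H+K\,|\nabla\phi-\phi H|\big)\,d\mu_t,$$ where $\overline Df(t)=\limsup_{h\to0}\frac{f(t+h)-f(t)}{h}$ and $H$ is the mean curvature vector, normalized so that ordinary mean curvature flow has velocity $H$. The flows considered are smooth flows of compact submanifolds with uniformly bounded mass. For an $n$-dimensional submanifold $\Sigma\subset\mathbb R^\ell$, the entropy is $$\lambda(\Sigma)=\sup_{x_0\in\mathbb R^\ell,\ t_0>0}F_{x_0,t_0}(\Sigma),\qquad F_{x_0,t_0}(\Sigma)=\frac{1}{(4\pi t_0)^{n/2}}\int_\Sigma e^{-\frac{|x-x_0|^2}{4t_0}}\,d\mu.$$ *)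

(* Defs.v *)
From HB Require Import structures.
From mathcomp Require Import all_boot all_order all_algebra.
From mathcomp Require Export all_classical all_reals all_analysis.

Set Implicit Arguments.
Unset Strict Implicit.
Unset Printing Implicit Defensive.

Import Order.TTheory GRing.Theory Num.Theory.
Import numFieldNormedType.Exports.

Local Open Scope classical_set_scope.
Local Open Scope ring_scope.

(* R^l is 'rV[R]_l.  Its library norm is the sup norm, which is used only for
   topology and differentiability; metric quantities use [enorm] below.
   [borel R l] is R^l with its Borel sigma-algebra. *)
Notation borel R l := (g_sigma_algebraType (@open 'rV[R]_l)).

Section euclidean.
Context {R : realType}.

Definition dot {l : nat} (x y : 'rV[R]_l) : R := \sum_(i < l) x 0 i * y 0 i.

Definition enorm {l : nat} (x : 'rV[R]_l) : R := Num.sqrt (dot x x).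

Fixpoint Ck {V W : normedModType R} (O : set V) (k : nat) (f : V -> W) : Prop :=
  match k with
  | 0%N => forall x, O x -> {for x, continuous f}
  | k'.+1 => (forall x, O x -> differentiable f x) /\
             (forall v : V, Ck O k' (fun x => 'D_v f x))
  end.

Definition compactly_supported {l : nat} {W : nmodType}
    (f : 'rV[R]_l -> W) : Prop :=
  compact (closure [set x | f x <> 0]).

Definition grad {l : nat} (phi : 'rV[R]_l -> R) (x : 'rV[R]_l) : 'rV[R]_l :=
  \row_(i < l) 'D_(delta_mx 0 i) phi x.

End euclidean.

Section hausdorff_measure.
Context {R : realType}.

(* omega_(n+2) = 2 pi / (n + 2) * omega_n *)
Fixpoint ball_volume (n : nat) : R :=
  match n with
  | 0%N => 1
  | 1%N => 2
  | m.+2 => 2 * pi / m.+2%:R * ball_volume m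
  end.

Definition diam {l : nat} (C : set 'rV[R]_l) : R :=
  sup [set enorm (p.1 - p.2) | p in C `*` C].

(* The empty set is treated apart because 0 ^+ 0 = 1. *)
Definition hausdorff_gauge {l : nat} (n : nat) (C : set 'rV[R]_l) : R :=
  if `[< C = set0 >] then 0 else ball_volume n * (diam C / 2) ^+ n.

Definition hausdorff_content {l : nat} (n : nat) (delta : R)
    (A : set 'rV[R]_l) : \bar R :=
  ereal_inf [set (\sum_(0 <= k <oo) (hausdorff_gauge n (C k))%:E)%E |
    C in [set C : nat -> set 'rV[R]_l | A `<=` \bigcup_k C k /\
      forall k x y, C k x -> C k y -> enorm (x - y) <= delta]].

(* Normalized so that it is Lebesgue measure on n-dimensional planes. *)
Definition hausdorff {l : nat} (n : nat) (A : set 'rV[R]_l) : \bar R :=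
  ereal_sup [set hausdorff_content n delta A | delta in [set d : R | 0 < d]].

End hausdorff_measure.

Section varifolds.
Context {R : realType} {l : nat}.

Definition radon (mu : {measure set (borel R l) -> \bar R}) : Prop :=
  forall C : set 'rV[R]_l, compact C -> (mu C < +oo)%E.

Definition rectifiable_set (n : nat) (E : set 'rV[R]_l) : Prop :=
  exists f : nat -> 'rV[R]_n -> 'rV[R]_l,
    (forall k, [lipschitz f k y | y in setT]) /\
    hausdorff n (E `\` \bigcup_k range (f k)) = 0%E.

(* mu = theta * (n-dimensional Hausdorff measure), with the integral of the
   integer-valued multiplicity theta written as a sum over its level sets. *)
Definition integer_rectifiable (n : nat)
    (mu : {measure set (borel R l) -> \bar R}) : Prop :=
  exists theta : borel R l -> nat,
    [/\ measurable_fun setT theta,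
        rectifiable_set n [set x | (0 < theta x)%N] &
        forall A : set (borel R l), measurable A ->
          mu A = (\sum_(0 <= k <oo)
            k%:R%:E * hausdorff n (A `&` theta @^-1` [set k]))%E].

Definition plane_projection (n : nat) (P : 'M[R]_l) : Prop :=
  [/\ P^T = P, P *m P = P & \rank P = n].

(* The n-plane [set v | v *m P = v] is the approximate tangent plane of mu at x
   for some multiplicity c > 0: the rescalings of mu about x converge weakly to
   c times the Hausdorff measure nu of the plane. *)
Definition approx_tangent_plane (n : nat)
    (mu : {measure set (borel R l) -> \bar R}) (x : 'rV[R]_l) (P : 'M[R]_l) :
    Prop :=
  plane_projection n P /\
  exists (nu : {measure set (borel R l) -> \bar R}) (c : R),
    [/\ 0 < c,
        forall A : set (borel R l), measurable A ->
          nu A = hausdorff n (A `&` [set v | v *m P = v]) &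
        forall phi : 'rV[R]_l -> R, continuous phi -> compactly_supported phi ->
          (fun r : R => r ^- n * \int[mu]_y phi (r^-1 *: (y - x))) @ 0^'+ -->
            c * \int[nu]_y phi y].

Definition tangent_field (n : nat) (mu : {measure set (borel R l) -> \bar R})
    (P : borel R l -> 'M[R]_l) : Prop :=
  (forall i j, measurable_fun setT (fun x => P x i j)) /\
  {ae mu, forall x, approx_tangent_plane n mu x (P x)}.

(* [jacobian] acts on row vectors, so this is \sum_(i, j) P i j * (d_i X_j). *)
Definition div_along (P : 'M[R]_l) (X : 'rV[R]_l -> 'rV[R]_l) (x : 'rV[R]_l) :
    R :=
  \tr (P *m jacobian X x).

(* Generalized mean curvature: minus the L^2_loc density of the first
   variation.  The condition H x *m P x = 0 (H is normal) is automatic for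
   integer multiplicity rectifiable varifolds, by Brakke's perpendicularity
   theorem, and for smooth submanifolds. *)
Definition mean_curvature (n : nat) (mu : {measure set (borel R l) -> \bar R})
    (H : borel R l -> 'rV[R]_l) : Prop :=
  [/\ forall i, measurable_fun setT (fun x => H x 0 i),
      forall C : set 'rV[R]_l, compact C ->
        (\int[mu]_(x in C) (enorm (H x) ^+ 2)%:E < +oo)%E &
      exists2 P : borel R l -> 'M[R]_l, tangent_field n mu P &
        {ae mu, forall x, H x *m P x = 0} /\
        forall X : 'rV[R]_l -> 'rV[R]_l, Ck setT 1 X -> compactly_supported X ->
          \int[mu]_x div_along (P x) X x = - \int[mu]_x dot (H x) (X x)].

End varifolds.

Section almost_brakke.
Context {R : realType} {l : nat}.

(* limsup of the two-sided difference quotient, over the h such that t + h lies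
   in the time interval I of definition of f (at a left endpoint belonging to I
   this is the right derivative). *)
Definition upper_derivative (I : set R) (f : R -> R) (t : R) : \bar R :=
  limf_esup (fun h : R => ((f (t + h) - f t) / h)%:E)
            (within [set h | I (t + h)] 0^').

(* The mean curvature vector is unique up to a null set, so the supremum is over
   at most one value; it is -oo, following the usual convention for Brakke
   flows, when there is no mean curvature vector in L^2_loc. *)
Definition brakke_rhs (n : nat) (K : R)
    (mu : {measure set (borel R l) -> \bar R}) (phi : 'rV[R]_l -> R) : \bar R :=
  ereal_sup [set (\int[mu]_x
      (- (phi x * enorm (H x) ^+ 2) + dot (grad phi x) (H x)
       + K * enorm (grad phi x - phi x *: H x))%:E)%E |
    H in [set H : borel R l -> 'rV[R]_l | mean_curvature n mu H]].

Definition almost_brakke_flow (n : nat) (K : R) (I : set R)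
    (mu : R -> {measure set (borel R l) -> \bar R}) : Prop :=
  [/\ forall t, I t -> radon (mu t),
      {ae (@lebesgue_measure R), forall t, I t -> integer_rectifiable n (mu t)} &
      forall phi : 'rV[R]_l -> R, Ck setT 1 phi -> compactly_supported phi ->
        (forall x, 0 <= phi x) ->
        forall t, I t ->
          (upper_derivative I (fun u => (\int[mu u]_x phi x)%R) t
             <= brakke_rhs n K (mu t) phi)%E].

End almost_brakke.

Section smooth_flows.
Context {R : realType} {l : nat}.

(* M t, for t in I, is a smoothly varying family of compact embedded
   n-dimensional submanifolds: the space-time track has local parametrizations
   psi (t, y), smooth in (t, y), which at each time are immersions and have the
   inverse chi, continuous on the track.  Compactness of the track over compact
   time intervals rules out components that vanish suddenly or escape to
   infinity. *)
Definition smooth_compact_flow (n : nat) (I : set R) (M : R -> set 'rV[R]_l) :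
    Prop :=
  (forall t0 x0, I t0 -> M t0 x0 ->
    exists (J : set R) (V : set 'rV[R]_n) (W : set 'rV[R]_l)
           (psi : R * 'rV[R]_n -> 'rV[R]_l) (chi : R * 'rV[R]_l -> 'rV[R]_n),
      [/\ [/\ open J, open V, open W, J t0 & W x0],
          forall k, Ck (J `*` V) k psi,
          forall t, I t -> J t ->
            [/\ [set psi (t, y) | y in V] = M t `&` W,
                forall y, V y -> chi (t, psi (t, y)) = y &
                forall y v, V y -> v <> 0 -> 'D_(0, v) psi (t, y) <> 0] &
          {within [set p | I p.1 /\ J p.1 /\ M p.1 p.2 /\ W p.2],
            continuous chi}]) /\
  (forall a b, I a -> I b ->
    compact [set p : R * 'rV[R]_l | a <= p.1 <= b /\ M p.1 p.2]).

Definition area_measure (n : nat) (M : set 'rV[R]_l)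
    (mu : {measure set (borel R l) -> \bar R}) : Prop :=
  forall A : set (borel R l), measurable A -> mu A = hausdorff n (A `&` M).

End smooth_flows.

Section entropy.
Context {R : realType} {l : nat}.

Definition gaussian_area (n : nat) (mu : {measure set (borel R l) -> \bar R})
    (x0 : 'rV[R]_l) (t0 : R) : \bar R :=
  (((4 * pi * t0) `^ (n%:R / 2))^-1%:E *
    \int[mu]_x (expR (- (enorm (x - x0) ^+ 2 / (4 * t0))))%:E)%E.

Definition entropy (n : nat) (mu : {measure set (borel R l) -> \bar R}) :
    \bar R :=
  ereal_sup [set gaussian_area n mu p.1 p.2 |
    p in [set p : 'rV[R]_l * R | 0 < p.2]].

End entropy.

(* Main.v *)
(* Write r = T0 - u and let Phi be the backward heat kernel
   (4 pi r)^(-n/2) exp(-|x - c|^2 / (4 r)).  Testing the flow with Phi, and adding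
   the first variation formula for the field grad Phi, gives as in Huisken's
   monotonicity formula
     d/du \int Phi dmu_u
       <= \int Phi (- |w|^2 + |y^T|^2 / (4 r^2) + K |w|) dmu_u,
   with y = x - c and w = H + y / (2 r), whose tangential part is y^T / (2 r).  The
   integrand is at most Phi (K^2 / 4 + K |y| / (2 r)), and Phi |y| / (2 r) is at most
   2^(n/2) r^(-1/2) times the heat kernel at scale 2 r.  So if L bounds all the
   Gaussian areas of the flow on [t, s], they increase by at most
   L (K^2 (s - t) / 4 + 2^(n/2) 2 K sqrt (s - t)).  When L is the supremum of the
   Gaussian areas at scales bounded below, it is finite because the mass is bounded,
   and for small K it can be absorbed.

   Since the test functions of the flow do not depend on time and have compact
   support, Phi is multiplied by a C^1 cutoff equal to 1 on a ball that contains
   M_u for all u in [t, s], and the inequality is integrated with one-sided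
   estimates only, without continuity of the measures in time. *)

Require Import Defs.
From mathcomp Require Import all_boot all_order all_algebra.
From mathcomp Require Import all_classical all_reals all_analysis.
From mathcomp Require Import measurable_realfun ring lra.
Import Order.TTheory GRing.Theory Num.Theory.
Import numFieldNormedType.Exports.
Local Open Scope classical_set_scope.
Local Open Scope ring_scope.

(** * Upper Dini derivatives *)

Section dini.
Context {R : realType}.
Implicit Types (f G : R -> R) (a b u r : R).

(** A bound [r] on the upper derivative relative to [[a, b]], for both signs of [h]. Negative [h]
    bounds [f u] from above by earlier values, which stands in for continuity from the left. *)
Definition dini_le a b f u r : Prop :=
  forall e, 0 < e -> exists2 d, 0 < d &
    forall h, h != 0 -> `|h| < d -> a <= u + h <= b ->
      (f (u + h) - f u) / h <= r + e.

(** For each slope [e' > 0], let [c] be the supremum of the set [S] of times at which [f] does not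
    exceed the line of slope [e'] through [(a, f a)]. Backward quotients at [c] put [c] in [S];
    forward quotients would go beyond [c] if [c < b]. *)
Lemma dini_le0_nonincreasing {a b f} : a <= b ->
  (forall u, a <= u <= b -> dini_le a b f u 0) -> f b <= f a.
Proof.
move=> ab fD; apply/ler_addgt0Pr => e e0.
(* The [+ 1] keeps the divisor positive when [a = b]. *)
pose e' := e / (b - a + 1).
have e'0 : 0 < e' by rewrite divr_gt0//; lra.
suff : f b <= f a + e' * (b - a).
  move=> /le_trans; apply; rewrite lerD2l /e' mulrAC ler_pdivrMr; last lra.
  by rewrite ler_wpM2l ?ltW//; lra.
pose S := [set v | a <= v <= b /\ f v <= f a + e' * (v - a)].
have Sa : S a by split; rewrite ?lexx// subrr mulr0 addr0.
have Sb : ubound S b by move=> v [/andP[]].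
have hS : has_sup S by split; [exists a | exists b].
pose c := sup S.
have ac : a <= c by apply: ub_le_sup => //; exists b.
have cb : c <= b by apply: ge_sup => //; exists a.
have [|d d0 dP] := fD c _ _ e'0; first by rewrite ac cb.
have Sc : S c.
  split; first by rewrite ac.
  have [v Sv cv] := sup_adherent d0 hS; rewrite -/c in cv.
  have vc : v <= c by apply: ub_le_sup => //; exists b.
  case: (eqVneq v c) => [<-|vNc]; first by case: Sv.
  have vltc : v < c by rewrite lt_neqAle vNc.
  case: Sv => [avb fv].
  have := dP (v - c); rewrite subr_eq0 vNc => /(_ isT).
  rewrite (_ : c + (v - c) = v); last by ring.
  rewrite ltr0_norm ?subr_lt0// avb add0r => /(_ _ isT) => H.
  have {H} : (f v - f c) / (v - c) <= e' by apply: H; lra.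
  rewrite ler_ndivrMr ?subr_lt0//; nra.
suff -> : b = c by case: Sc.
apply/eqP; rewrite eq_le cb andbT leNgt; apply/negP => cltb.
pose h := Num.min (d / 2) (b - c).
have h0 : 0 < h by rewrite lt_min divr_gt0//= subr_gt0.
have hd : h < d by rewrite gt_min; apply/orP; left; lra.
have hb : h <= b - c by rewrite ge_min lexx orbT.
have chb : a <= c + h <= b by lra.
have := dP h; rewrite gt_eqF// gtr0_norm// => /(_ isT hd chb).
rewrite add0r ler_pdivrMr// => fch.
have : S (c + h) by split => //; case: Sc => _; nra.
move=> /(ub_le_sup (ex_intro _ b Sb)); rewrite -/c; lra.
Qed.

Lemma dini_le_subr {a b f G u r} : dini_le a b f u r -> is_derive u 1 G r ->
  dini_le a b (f \- G) u 0.
Proof.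
move=> fr [dG Gr] e e0; have e20 : 0 < e / 2 by rewrite divr_gt0.
have [d d0 dP] := fr _ e20.
have /cvgrPdist_lt /(_ _ e20) : (fun h => h^-1 *: (G (h *: 1 + u) - G u)) @ 0^' --> r.
  by rewrite -Gr; exact: dG.
move=> /nbhs_ballP[d' /= d'0 d'P].
exists (Num.min d d'); first by rewrite lt_min d0.
move=> h h0; rewrite lt_min => /andP[hd hd'] hab.
have := dP h h0 hd hab.
have : `|r - h^-1 *: (G (h *: 1 + u) - G u)| < e / 2.
  by apply: d'P; [rewrite /ball/= sub0r normrN | ].
rewrite /GRing.scale/= mulr1 [h + u]addrC ltr_norml => /andP[_ Gh].
rewrite (_ : (f (u + h) - G (u + h) - (f u - G u)) / h =
  (f (u + h) - f u) / h - h^-1 * (G (u + h) - G u)); last by ring.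
lra.
Qed.

Lemma dini_le_integrate {a b f G} (g : R -> R) : a <= b ->
  (forall u, a <= u <= b -> is_derive u 1 G (g u)) ->
  (forall u, a <= u <= b -> dini_le a b f u (g u)) ->
  f b - f a <= G b - G a.
Proof.
move=> ab GD fD.
have := @dini_le0_nonincreasing a b (f \- G) ab.
have H u : a <= u <= b -> dini_le a b (f \- G) u 0.
  by move=> uab; exact: dini_le_subr (fD u uab) (GD u uab).
move=> /(_ H) /=; lra.
Qed.

(* With [p v] the integral of phi_u and [q v] the integral of its time
   derivative psi_u against the measure at time v, this differentiates
   f v = \int phi_v.  No continuity of [q] is required: writing
   phi_u + h psi_u = (1 - h C) phi_u + h (C phi_u + psi_u), only upper bounds on
   the derivatives of the integrals of nonnegative functions are used. *)
Lemma dini_le_moving {a b f} {p q : R -> R} {u r C B : R} : 0 <= C ->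
  f u = p u ->
  dini_le a b p u r ->
  dini_le a b (fun v => C * p v + q v) u B ->
  dini_le a b (fun v => C * p v - q v) u B ->
  (forall e, 0 < e -> exists2 d, 0 < d & forall h, `|h| < d ->
     a <= u + h <= b -> `|f (u + h) - p (u + h) - h * q (u + h)| <= e * `|h|) ->
  dini_le a b f u (r + q u).
Proof.
move=> C0 fu pD qD1 qD2 fD e e0.
have e30 : 0 < e / 4 by rewrite divr_gt0.
have [d1 d10 d1P] := pD _ e30.
(* Tolerance 1 is enough for these two quotients, since they enter with a further factor [h]. *)
have [d2 d20 d2P] := qD1 _ ltr01.
have [d3 d30 d3P] := qD2 _ ltr01.
have [d4 d40 d4P] := fD _ e30.
(* Making [|h| * W] smaller than 1 and [e / 4] keeps the weight [1 - |h| C] positive and the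
   second-order term at most [e / 4]. *)
pose W := `|C * (r + e / 4)| + `|B + 1| + C + 1.
have W0 : 0 < W by rewrite /W; have := normr_ge0 (C * (r + e / 4));
    have := normr_ge0 (B + 1); lra.
pose d5 := Num.min 1 (e / 4) / W.
have d50 : 0 < d5 by rewrite divr_gt0// lt_min ltr01.
exists (Num.min (Num.min d1 d2) (Num.min (Num.min d3 d4) d5)).
  by rewrite !lt_min d10 d20 d30 d40.
move=> h h0; rewrite !lt_min => /andP[/andP[hd1 hd2] /andP[/andP[hd3 hd4]]].
rewrite /d5 ltr_pdivlMr// lt_min => /andP[hW1 hW2] hab.
have := d1P h h0 hd1 hab; have := d4P h hd4 hab.
have {}d2P := d2P h h0 hd2 hab; have {}d3P := d3P h h0 hd3 hab.
rewrite fu; set P := p (u + h) in d2P d3P *; set Q := q (u + h) in d2P d3P *.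
set F := f (u + h).
rewrite ler_norml => /andP[F1 F2] pP.
have W1 : `|C * (r + e / 4)| + `|B + 1| <= W by rewrite /W; lra.
have W2 : C <= W.
  by rewrite /W; have := normr_ge0 (C * (r + e / 4)); have := normr_ge0 (B + 1); lra.
have hC : `|h| * C < 1 by apply: le_lt_trans hW1; rewrite ler_wpM2l.
have hB : `|h| * (B + 1 - C * (r + e / 4)) <= e / 4.
  apply: le_trans (ltW hW2); rewrite ler_wpM2l//; apply: le_trans W1.
  by have := ler_norm (B + 1); have := ler_norm (- (C * (r + e / 4)));
      rewrite normrN; lra.
(* For [h < 0] the splitting is phi_u + h psi_u = (1 + h C) phi_u - h (C phi_u - psi_u), again with
   nonnegative weights; this is where the bound for [C * p v - q v] is used. *)
case/orP: (lt_total h0) => [hlt|hgt].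
- move: F1 F2 hC hB; rewrite ltr0_norm// => F1 F2 hC hB.
  move: pP d3P; rewrite !ler_ndivrMr// => pP d3P.
  have k0 : 0 < - h by lra.
  have : (1 + h * C) * (P - p u) >= (1 + h * C) * ((r + e / 4) * h).
    by rewrite ler_wpM2l//; lra.
  have := ler_wpM2l (ltW k0) d3P; have := ler_wpM2l (ltW k0) hB; lra.
- move: F1 F2 hC hB; rewrite gtr0_norm// => F1 F2 hC hB.
  move: pP d2P; rewrite !ler_pdivrMr// => pP d2P.
  have : (1 - h * C) * (P - p u) <= (1 - h * C) * ((r + e / 4) * h).
    by rewrite ler_wpM2l//; lra.
  have := ler_wpM2l (ltW hgt) d2P; have := ler_wpM2l (ltW hgt) hB; lra.
Qed.

Lemma upper_derivative_dini_le {I : set R} {f a b u r} :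
  (forall v, a <= v <= b -> I v) -> (upper_derivative I f u <= r%:E)%E ->
  dini_le a b f u r.
Proof.
move=> abI fr e e0.
have : (upper_derivative I f u < (r + e)%:E)%E.
  by apply: le_lt_trans fr _; rewrite lte_fin; lra.
move=> /ereal_inf_lt[_ [V /nbhs_ballP[d d0 dV] <-]] Vr.
exists d => // h h0 hd hab; rewrite -lee_fin; apply: le_trans (ltW Vr).
apply: ereal_sup_ubound; exists h => //; apply: dV => //.
  by rewrite /ball/= sub0r normrN.
exact: abI.
Qed.

End dini.

(** * Euclidean geometry of row vectors *)

Section dot.
Context {R : realType} {l : nat}.
Implicit Types (x y z v : 'rV[R]_l) (k : R).

Lemma dotC x y : dot x y = dot y x.
Proof. by apply: eq_bigr => i _; rewrite mulrC. Qed.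

Lemma dotDl x y z : dot (x + y) z = dot x z + dot y z.
Proof. by rewrite -big_split; apply: eq_bigr => i _; rewrite mxE mulrDl. Qed.

Lemma dotZl k x y : dot (k *: x) y = k * dot x y.
Proof. by rewrite mulr_sumr; apply: eq_bigr => i _; rewrite mxE mulrA. Qed.

Lemma dotDr x y z : dot x (y + z) = dot x y + dot x z.
Proof. by rewrite dotC dotDl !(dotC x). Qed.

Lemma dotZr k x y : dot x (k *: y) = k * dot x y.
Proof. by rewrite dotC dotZl dotC. Qed.

Lemma dotNl x y : dot (- x) y = - dot x y.
Proof. by rewrite -scaleN1r dotZl mulN1r. Qed.

Lemma dotNr x y : dot x (- y) = - dot x y.
Proof. by rewrite dotC dotNl dotC. Qed.

Definition dotE := (dotDl, dotDr, dotNl, dotNr, dotZl, dotZr).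

Lemma dot_ge0 x : 0 <= dot x x.
Proof. by apply: sumr_ge0 => i _; rewrite -expr2 sqr_ge0. Qed.

Lemma enorm_ge0 x : 0 <= enorm x.
Proof. exact: sqrtr_ge0. Qed.

Lemma sqr_enorm x : enorm x ^+ 2 = dot x x.
Proof. by rewrite sqr_sqrtr// dot_ge0. Qed.

Lemma enormZ k x : enorm (k *: x) = `|k| * enorm x.
Proof. by rewrite /enorm !dotE mulrA -expr2 sqrtrM ?sqr_ge0// sqrtr_sqr. Qed.

Lemma dot_mulmx (P : 'M[R]_l) x y : dot (x *m P) y = dot x (y *m P^T).
Proof.
rewrite /dot; under eq_bigr do rewrite mxE mulr_suml.
rewrite exchange_big; apply: eq_bigr => j _ /=.
by rewrite mxE mulr_sumr; apply: eq_bigr => i _; rewrite mxE -mulrA (mulrC (y _ _)).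
Qed.

Lemma dot_delta x i : dot x (delta_mx 0 i) = x 0 i.
Proof.
rewrite /dot (bigD1 i)//= mxE !eqxx mulr1 big1 ?addr0// => j ji.
by rewrite mxE eqxx (negbTE ji) mulr0.
Qed.

End dot.

Section projection.
Context {R : realType} {l : nat}.
Implicit Types (P : 'M[R]_l) (v w : 'rV[R]_l).

(** In the rank factorization of [P], idempotence forces the product of the factors in the reverse
    order to be the identity matrix of size [\rank P]. *)
Lemma mxtrace_idempotent P : P *m P = P -> \tr P = (\rank P)%:R.
Proof.
move=> PP; rewrite -{1}(mulmx_base P) mxtrace_mulC.
suff -> : row_base P *m col_base P = 1%:M by rewrite mxtrace1.
apply: (row_free_inj (row_base_free P)); rewrite mul1mx.
apply: (row_full_inj (col_base_full P)).
have -> : col_base P *m (row_base P *m col_base P *m row_base P) =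
  (col_base P *m row_base P) *m (col_base P *m row_base P) by rewrite !mulmxA.
by rewrite mulmx_base.
Qed.

Lemma dot_projection n P v : plane_projection n P ->
  dot (v *m P) (v *m P) = dot v (v *m P).
Proof. by move=> [PT PP _]; rewrite dot_mulmx PT -mulmxA PP. Qed.

Lemma dot_projection_le n P v : plane_projection n P ->
  dot (v *m P) (v *m P) <= dot v v.
Proof.
move=> hP; have := dot_ge0 (v - v *m P).
rewrite !dotE (dotC (v *m P) v) (dot_projection _ _ _ hP); lra.
Qed.

End projection.

(** * Functions of the squared distance to a point *)

Section derivatives.
Context {R : realType}.

(** Turns limits into algebra with a quadratic remainder, both for [quad] along a line and for
    [sqrpos], whose formula changes at 0. *)
Lemma is_derive_of_sqr_bound {f : R -> R} {x d C : R} :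
  (forall h, `|f (x + h) - f x - d * h| <= C * h ^+ 2) -> is_derive x 1 f d.
Proof.
move=> fC; suff H : h^-1 *: ((f \o shift x) (h *: 1) - f x) @[h --> 0^'] --> d.
  by split; [apply/cvg_ex; exists d | exact: cvg_lim].
apply/cvgrPdist_le => e e0; apply/nbhs_ballP.
have C10 : 0 < `|C| + 1 by have := normr_ge0 C; lra.
exists (e / (`|C| + 1)); first by rewrite /= divr_gt0.
move=> h; rewrite /ball/= sub0r normrN ltr_pdivlMr// => he h0.
rewrite /shift/= distrC [h *: 1]mulr1 [h + x]addrC [_ *: _]mulrC.
have -> : (f (x + h) - f x) / h - d = (f (x + h) - f x - d * h) / h by field.
rewrite normrM normfV ler_pdivrMr ?normr_gt0//; apply: le_trans (fC h) _.
rewrite -(real_normK (num_real h)) expr2 mulrA ler_wpM2r//.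
by apply: le_trans (ltW he); rewrite mulrC ler_wpM2l//; have := ler_norm C; lra.
Qed.

Context {V : normedModType R}.

Lemma derive_comp1 {f : V -> R} {g g' : R -> R} {x : V} :
  differentiable f x -> (forall r : R, is_derive r 1 g (g' r)) ->
  differentiable (fun y => g (f y)) x /\
  forall v, 'D_v (fun y => g (f y)) x = g' (f x) * 'D_v f x.
Proof.
move=> df dg.
have dgx : differentiable g (f x) by apply/derivable1_diffP; case: (dg (f x)).
split=> [|v]; first exact: (@differentiable_comp _ _ _ _ f g).
rewrite deriveE; last exact: (@differentiable_comp _ _ _ _ f g).
rewrite (@diff_comp _ _ _ _ f g)//= deriveE// deriv1E; last by case: (dg (f x)).
by rewrite derive1E (@derive_val _ _ _ _ _ _ _ (dg (f x))) [LHS]mulrC.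
Qed.

End derivatives.

Section quad.
Context {R : realType} {l : nat}.

Definition quad (c x : 'rV[R]_l) : R := dot (x - c) (x - c).

Lemma quad_ge0 c x : 0 <= quad c x. Proof. exact: dot_ge0. Qed.

Lemma differentiable_quad c x : differentiable (quad c) x.
Proof.
rewrite (_ : quad c = \sum_(i < l) (fun y : 'rV[R]_l => y 0 i - c 0 i) ^+ 2).
  apply: differentiable_sum => i.
  apply: differentiableX.
  apply: differentiableB; last exact: differentiable_cst.
  exact: differentiable_coord.
apply/funext => y; rewrite /quad /dot fct_sumE.
by apply: eq_bigr => i _; rewrite exprfctE !mxE expr2.
Qed.

Lemma continuous_quad c : continuous (quad c).
Proof. by move=> x; apply: differentiable_continuous; exact: differentiable_quad. Qed.

Lemma derive_quad c x v : 'D_v (quad c) x = 2 * dot (x - c) v.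
Proof.
have : derivable (quad c) x v by apply: diff_derivable; exact: differentiable_quad.
(* Along a line the squared distance is quadratic in [h], with second-order term exactly
   [h ^+ 2 * dot v v]. *)
pose g (h : R) := quad c (x + h *: v).
have gE h : g h = quad c x + h * (2 * dot (x - c) v) + h ^+ 2 * dot v v.
  rewrite /g /quad addrAC (dotDl (x - c)) !(dotDr (x - c)) (dotDr (h *: v)) !dotE.
  by rewrite !(dotC v); ring.
have : is_derive (0 : R) 1 g (2 * dot (x - c) v).
  apply: (@is_derive_of_sqr_bound _ _ _ _ (dot v v)) => h.
  rewrite !gE add0r expr0n/= !mul0r !addr0.
  rewrite (_ : _ - _ = dot v v * h ^+ 2); last by ring.
  by rewrite ger0_norm// mulr_ge0 ?dot_ge0 ?sqr_ge0.
move=> [_ <-] _; rewrite /derive.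
suff -> : (fun h : R => h^-1 *: ((quad c \o shift x) (h *: v) - quad c x)) =
  (fun h : R => h^-1 *: ((g \o shift 0) (h *: 1) - g 0)) by [].
apply/funext => h /=; rewrite /g /shift /= !addr0 scale0r addr0.
by rewrite [h *: 1]mulr1 [h *: v + x]addrC.
Qed.

Lemma continuous_dotl (c v : 'rV[R]_l) : continuous (fun x : 'rV[R]_l => dot (x - c) v).
Proof.
move=> x; apply: differentiable_continuous.
rewrite (_ : (fun _ => _) =
    \sum_(i < l) (fun y : 'rV[R]_l => (y 0 i - c 0 i) * v 0 i)).
  apply: differentiable_sum => i; apply: differentiableM; last first.
    exact: differentiable_cst.
  by apply: differentiableB; [exact: differentiable_coord | exact: differentiable_cst].
by apply/funext => y; rewrite /dot fct_sumE; apply: eq_bigr => i _; rewrite !mxE.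
Qed.

End quad.

Definition has_C1_derivative {R : realType} (a a' : R -> R) : Prop :=
  (forall r : R, is_derive r 1 a (a' r)) /\ continuous a'.

Lemma has_C1_derivative_continuous {R : realType} {a a' : R -> R} :
  has_C1_derivative a a' -> continuous a.
Proof.
move=> [da _] r; apply: differentiable_continuous.
by apply/derivable1_diffP; case: (da r).
Qed.

(** * Products of a profile of |x|^2 and a profile of |x - c|^2 *)

Section bump_fun.
Context {R : realType} {l : nat} (c : 'rV[R]_l).
Context {a a' b b' : R -> R}.
Hypotheses (ha : has_C1_derivative a a') (hb : has_C1_derivative b b').

(** In use [f] is a cutoff about the origin, independent of the centre [c], and [g] is a Gaussian
    profile about [c]. *)
Definition bump_fun (f g : R -> R) (x : 'rV[R]_l) : R := f (quad 0 x) * g (quad c x).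

Definition dbump (x v : 'rV[R]_l) : R :=
  2 * a' (quad 0 x) * b (quad c x) * dot (x - 0) v
  + 2 * a (quad 0 x) * b' (quad c x) * dot (x - c) v.

Lemma differentiable_bump x : differentiable (bump_fun a b) x.
Proof.
have [dA _] := derive_comp1 (differentiable_quad 0 x) (proj1 ha).
have [dB _] := derive_comp1 (differentiable_quad c x) (proj1 hb).
exact: (@differentiableM _ _ (fun y => a (quad 0 y)) (fun y => b (quad c y))).
Qed.

Lemma derive_bump x v : 'D_v (bump_fun a b) x = dbump x v.
Proof.
have [dA A'] := derive_comp1 (differentiable_quad 0 x) (proj1 ha).
have [dB B'] := derive_comp1 (differentiable_quad c x) (proj1 hb).
rewrite (@deriveM _ _ (fun y => a (quad 0 y)) (fun y => b (quad c y)));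
  [|exact: diff_derivable..].
by rewrite A' B' !derive_quad /dbump /GRing.scale/=; ring.
Qed.

Lemma continuous_dbump v : continuous (dbump ^~ v).
Proof.
have [[_ ca'] [_ cb']] := (ha, hb).
have ca := has_C1_derivative_continuous ha.
have cb := has_C1_derivative_continuous hb.
have cq (f : R -> R) (d : 'rV[R]_l) : continuous f -> continuous (fun x : 'rV[R]_l
    => f (quad d x)).
  by move=> cf x; have := continuous_comp (@continuous_quad _ _ d x) (cf _); exact.
have cM (f g : 'rV[R]_l -> R) : continuous f -> continuous g ->
    continuous (fun x => f x * g x).
  by move=> cf cg x; exact: cvgM (cf x) (cg x).
have cD (f g : 'rV[R]_l -> R) : continuous f -> continuous g ->
    continuous (fun x => f x + g x).
  by move=> cf cg x; exact: cvgD (cf x) (cg x).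
have c2 : continuous (fun _ : 'rV[R]_l => 2 : R).
  exact: cst_continuous.
have cq1 := cq _ 0 ca; have cq2 := cq _ 0 ca'.
have cq3 := cq _ c cb; have cq4 := cq _ c cb'.
exact: (cD _ _ (cM _ _ (cM _ _ (cM _ _ c2 cq2) cq3) (@continuous_dotl _ _ 0 v))
               (cM _ _ (cM _ _ (cM _ _ c2 cq1) cq4) (@continuous_dotl _ _ c v))).
Qed.

Lemma Ck_bump : Ck setT 1 (bump_fun a b).
Proof.
split=> [x _|v x _]; first exact: differentiable_bump.
rewrite (_ : (fun _ => _) = dbump ^~ v); first exact: continuous_dbump.
by apply/funext => y; exact: derive_bump.
Qed.

(** The vector field for the first variation formula: with a suitable Gaussian profile it equals the
    gradient of the heat kernel wherever the cutoff is 1. *)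
Definition radial_field (x : 'rV[R]_l) : 'rV[R]_l := bump_fun a b x *: (x - c).

Lemma derive_coord (x v : 'rV[R]_l) j (d : 'rV[R]_l) :
  'D_v (fun y : 'rV[R]_l => y 0 j - d 0 j) x = v 0 j.
Proof.
have dj : differentiable (fun y : 'rV[R]_l => y 0 j) x by exact: differentiable_coord.
rewrite deriveB; [|exact: diff_derivable|exact: derivable_cst].
rewrite derive_cst subr0.
have := @derive_mx _ _ _ _ id x v (@derivable_id _ _ x v).
by rewrite derive_id => /(congr1 (fun M : 'rV[R]_l => M 0 j)); rewrite mxE.
Qed.

Lemma differentiable_radial_field x : differentiable radial_field x.
Proof.
rewrite (_ : radial_field =
    \sum_(i < l) (fun y => (bump_fun a b y * (y 0 i - c 0 i)) *: (delta_mx 0 i :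
        'rV[R]_l))).
  apply: differentiable_sum => i; apply: differentiableZl.
  apply: differentiableM; first exact: differentiable_bump.
  by apply: differentiableB; [exact: differentiable_coord | exact: differentiable_cst].
apply/funext => y; rewrite /radial_field fct_sumE; apply/rowP => j.
rewrite summxE (bigD1 j)//= !mxE !eqxx mulr1 big1 ?addr0// => i ij.
by rewrite !mxE eqxx eq_sym (negbTE ij) mulr0.
Qed.

Lemma derive_radial_field x v :
  'D_v radial_field x = dbump x v *: (x - c) + bump_fun a b x *: v.
Proof.
rewrite derive_mx; last by apply: diff_derivable; exact: differentiable_radial_field.
apply/rowP => j; rewrite !mxE -derive_bump.
rewrite (_ : (fun _ => _) = bump_fun a b * (fun y : 'rV[R]_l => y 0 j - c 0 j));
    last first.
  by apply/funext => y; rewrite /radial_field !mxE.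
have dc : differentiable (fun y : 'rV[R]_l => y 0 j - c 0 j) x.
  by apply: differentiableB; [exact: differentiable_coord | exact: differentiable_cst].
rewrite deriveM; [|apply: diff_derivable..] => //; last exact: differentiable_bump.
rewrite (derive_coord x v j c) /GRing.scale/=; ring.
Qed.

Lemma Ck_radial_field : Ck setT 1 radial_field.
Proof.
split=> [x _|v x _]; first exact: differentiable_radial_field.
rewrite (_ : (fun _ => _) = fun x => dbump x v *: (x - c) + bump_fun a b x *: v);
    last first.
  by apply/funext => y; exact: derive_radial_field.
have c1 : bump_fun a b y @[y --> x] --> bump_fun a b x.
  exact: differentiable_continuous (differentiable_bump x).
have c2 : dbump y v @[y --> x] --> dbump x v by exact: continuous_dbump.
have c3 : (y - c) @[y --> x] --> x - c by exact: cvgB cvg_id (cvg_cst c).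
exact: cvgD (cvgZ c2 c3) (cvgZ c1 (cvg_cst v)).
Qed.

End bump_fun.

(** * Cutoff functions *)

Section cutoff.
Context {R : realType}.
Implicit Types r rho : R.

(* The square of max(r, 0). *)
Definition sqrpos r : R := (r ^+ 2 + r * `|r|) / 2.
Definition dsqrpos r : R := r + `|r|.

Lemma sqrpos_le0 r : r <= 0 -> sqrpos r = 0.
Proof. by move=> r0; rewrite /sqrpos ler0_norm//; field. Qed.

Lemma sqrpos_gt0 r : 0 <= r -> sqrpos r = r ^+ 2.
Proof. by move=> r0; rewrite /sqrpos ger0_norm//; field. Qed.

Lemma sqrpos_ge0 r : 0 <= sqrpos r.
Proof.
by case: (lerP 0 r) => [/sqrpos_gt0->|/ltW/sqrpos_le0->//]; exact: sqr_ge0.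
Qed.

Lemma dsqrpos_le0 r : r <= 0 -> dsqrpos r = 0.
Proof. by move=> r0; rewrite /dsqrpos ler0_norm// subrr. Qed.

Lemma sqrpos_C1 : has_C1_derivative sqrpos dsqrpos.
Proof.
split=> [r|r]; last by apply: cvgD; [exact: cvg_id | exact: norm_continuous].
apply: (@is_derive_of_sqr_bound _ _ _ _ 1) => h.
rewrite mul1r /sqrpos /dsqrpos.
(* In the two mixed cases 0 lies between [r] and [r + h], so both are at most [|h|] in absolute
   value. *)
case: (ger0P r) => r0; case: (ger0P (r + h)) => rh0.
- rewrite (_ : _ - _ - _ = h ^+ 2); last by field.
  by rewrite ger0_norm ?sqr_ge0.
- rewrite (_ : _ - _ - _ = - (r ^+ 2 + 2 * r * h)); last by field.
  by rewrite ler_norml; nra.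
- rewrite (_ : _ - _ - _ = (r + h) ^+ 2); last by field.
  by rewrite ger0_norm ?sqr_ge0//; nra.
- rewrite (_ : _ - _ - _ = 0); last by field.
  by rewrite normr0 sqr_ge0.
Qed.

(** A C^1 cutoff in the variable r = |x|^2: it is 1 up to [rho] and 0 from [rho + 1] on. *)
Definition cutoff rho r : R := sqrpos (1 - sqrpos (r - rho)).
Definition dcutoff rho r : R :=
  - (dsqrpos (1 - sqrpos (r - rho)) * dsqrpos (r - rho)).

Lemma cutoff_ge0 rho r : 0 <= cutoff rho r.
Proof. exact: sqrpos_ge0. Qed.

Lemma cutoff1 rho r : r <= rho -> cutoff rho r = 1.
Proof. by move=> rrho; rewrite /cutoff [sqrpos (r - rho)]sqrpos_le0 ?subr0
    ?sqrpos_gt0 ?expr1n// subr_le0. Qed.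

Lemma dcutoff0 rho r : r <= rho -> dcutoff rho r = 0.
Proof. by move=> rrho; rewrite /dcutoff [dsqrpos (r - rho)]dsqrpos_le0 ?mulr0
    ?oppr0// subr_le0. Qed.

Lemma cutoff0 rho r : rho + 1 <= r -> cutoff rho r = 0.
Proof.
move=> rrho; rewrite /cutoff [X in 1 - X]sqrpos_gt0; last by lra.
by apply: sqrpos_le0; nra.
Qed.

Lemma cutoff_C1 rho : has_C1_derivative (cutoff rho) (dcutoff rho).
Proof.
have [dm cm'] := sqrpos_C1.
have cm := has_C1_derivative_continuous sqrpos_C1.
have cs : continuous (fun r : R => r - rho).
  by move=> r; apply: cvgB; [exact: cvg_id | exact: cvg_cst].
split=> r.
  have d1 : is_derive r 1 (fun r : R => r - rho) 1.
    by rewrite -[X in is_derive _ _ _ X]subr0; exact: is_deriveB.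
  have d2 : is_derive r 1 (fun r : R => sqrpos (r - rho)) (dsqrpos (r - rho) * 1).
    exact: (@is_derive1_comp _ sqrpos (fun r : R => r - rho)).
  have d3 : is_derive r 1 (fun r : R => 1 - sqrpos (r - rho)) (0 - dsqrpos (r -
      rho) * 1).
    exact: is_deriveB.
  have := @is_derive1_comp _ sqrpos (fun r : R => 1 - sqrpos (r - rho)) _ _ _ (dm _) d3.
  by rewrite (_ : _ * _ = dcutoff rho r); last by rewrite /dcutoff; ring.
have c1 : continuous (fun r => sqrpos (r - rho)).
  by move=> x; have := continuous_comp (cs x) (cm _); exact.
have c2 : continuous (fun r => 1 - sqrpos (r - rho)).
  by move=> x; apply: cvgB; [exact: cvg_cst | exact: c1].
have c3 : continuous (fun r => dsqrpos (1 - sqrpos (r - rho))).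
  by move=> x; have := continuous_comp (c2 x) (cm' _); exact.
have c4 : continuous (fun r => dsqrpos (r - rho)).
  by move=> x; have := continuous_comp (cs x) (cm' _); exact.
by apply: cvgN; exact: (cvgM (c3 r) (c4 r)).
Qed.

End cutoff.

(** * Sup norm against Euclidean norm, compact supports, Borel measurability *)

Section space.
Context {R : realType} {l : nat}.

Lemma sqr_norm_le_quad (x : 'rV[R]_l) : `|x| ^+ 2 <= quad 0 x.
Proof.
rewrite -[leRHS]sqr_sqrtr ?quad_ge0// lerXn2r ?nnegrE ?sqrtr_ge0//.
rewrite [leLHS]/Num.Def.normr/= mx_normrE.
apply: bigmax_le => [|[i j] _ /=]; first exact: sqrtr_ge0.
rewrite -sqrtr_sqr ler_wsqrtr// /quad subr0 /dot (bigD1 j)//= (ord1 i) expr2 lerDl.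
by apply: sumr_ge0 => k _; rewrite -expr2 sqr_ge0.
Qed.

Lemma quad_le_sqr_norm (x : 'rV[R]_l) : quad 0 x <= l%:R * `|x| ^+ 2.
Proof.
rewrite /quad subr0 /dot mulr_natl -[X in _ *+ X]card_ord -sumr_const.
apply: ler_sum => i _; rewrite -expr2 -(real_normK (num_real (x 0 i))).
rewrite lerXn2r ?nnegrE// [leRHS]/Num.Def.normr/= mx_normrE.
exact: (le_bigmax _ (fun p : 'I_1 * 'I_l => `|x p.1 p.2|) (0, i)).
Qed.

Lemma compact_quad_le (rho : R) : compact [set x : 'rV[R]_l | quad 0 x <= rho].
Proof.
apply: bounded_closed_compact; last first.
  apply: (@closed_comp _ _ (quad 0) [set r | r <= rho]); last exact: closed_le.
  by move=> x _; exact: continuous_quad.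
exists (1 + `|rho|); split; first exact: num_real.
move=> M rM x /= xrho; apply: le_trans (ltW rM).
have := sqr_norm_le_quad x; have := normr_ge0 x; have := ler_norm rho; nra.
Qed.

Lemma compactly_supported_of_quad {W : nmodType} {f : 'rV[R]_l -> W} {rho : R} :
  (forall x, rho < quad 0 x -> f x = 0) -> compactly_supported f.
Proof.
move=> f0; apply: subclosed_compact (compact_quad_le rho) _;
    first exact: closed_closure.
rewrite closureE; apply: smallest_sub => [|x /= fx].
  exact: compact_closed (@norm_hausdorff _ _) (compact_quad_le rho).
by rewrite leNgt; apply/negP => /f0.
Qed.

Lemma continuous_measurable_rV {f : 'rV[R]_l -> R} :
  continuous f -> measurable_fun setT (f : borel R l -> R).
Proof.
move=> /continuousP cf; apply: (measurability _
    (measurable_realfun.RGenOpens.measurableE R)).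
move=> _ [_ [a [b ->] <-]]; rewrite setTI; apply: sub_sigma_algebra.
exact/cf/interval_open.
Qed.

Lemma measurable_quad_gt (c : 'rV[R]_l) rho :
  measurable ([set x | rho < quad c x] : set (borel R l)).
Proof.
apply: sub_sigma_algebra.
rewrite (_ : [set x | _] = quad c @^-1` [set r | rho < r])//.
apply: open_comp; last exact: open_gt.
by move=> x _; exact: continuous_quad.
Qed.

End space.

(** * Integrals of functions compared almost everywhere *)

Section ae_integral.
Context {d} {T : measurableType d} {R : realType} {mu : {measure set T -> \bar R}}.

Lemma ae_imp {P Q : T -> Prop} : (forall x, P x -> Q x) ->
  {ae mu, forall x, P x} -> {ae mu, forall x, Q x}.
Proof. by move=> PQ; apply: filterS. Qed.

Lemma ae_and {P Q : T -> Prop} : {ae mu, forall x, P x} -> {ae mu, forall x, Q x} ->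
  {ae mu, forall x, P x /\ Q x}.
Proof. by move=> aP aQ; apply: filterI. Qed.

(** Positive and negative parts are compared separately, so no integrability is required; the Brakke
    integrand is only known to be measurable. *)
Lemma ae_le_integral (f g : T -> \bar R) :
  measurable_fun setT f -> measurable_fun setT g ->
  {ae mu, forall x, (f x <= g x)%E} ->
  (\int[mu]_x f x <= \int[mu]_x g x)%E.
Proof.
move=> mf mg fg; rewrite integralE [leRHS]integralE leeB//.
- apply: ae_ge0_le_integral => //; [exact: measurable_funepos..|].
  apply: filterS fg => x fgx _.
  by rewrite !funeposE ge_max !le_max fgx lexx orbT.
- apply: ae_ge0_le_integral => //; [exact: measurable_funeneg..|].
  apply: filterS fg => x fgx _.
  by rewrite !funenegE ge_max !le_max leeN2 fgx lexx orbT.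
Qed.

Lemma ae_le_integrable (f g : T -> R) :
  measurable_fun setT f -> mu.-integrable setT (EFin \o g) ->
  {ae mu, forall x, `|f x| <= g x} -> mu.-integrable setT (EFin \o f).
Proof.
move=> mf ig fg; have mEf := (measurable_EFinP _ _).2 mf; apply/integrableP;
    split => //.
apply: le_lt_trans (_ : (\int[mu]_x `|(EFin \o g) x|)%E < +oo)%E;
    last by case/integrableP: ig.
apply: ae_ge0_le_integral => //.
- exact: measurableT_comp.
- by apply: measurableT_comp => //; exact: measurable_int ig.
- apply: filterS fg => x fgx _; rewrite /= lee_fin; exact: le_trans (ler_norm _).
Qed.

Lemma ae_bounded_integrable (f : T -> R) (M : R) :
  (mu setT < +oo)%E -> measurable_fun setT f ->
  {ae mu, forall x, `|f x| <= M} -> mu.-integrable setT (EFin \o f).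
Proof.
move=> mufin mf fM; apply: (@ae_le_integrable f (cst M)) => //.
apply: measurable_bounded_integrable => //.
by exists `|M|; split => // N MN x _ /=; exact: ltW.
Qed.

Lemma ae_le_Rintegral (f g : T -> R) :
  mu.-integrable setT (EFin \o f) -> mu.-integrable setT (EFin \o g) ->
  {ae mu, forall x, f x <= g x} -> \int[mu]_x f x <= \int[mu]_x g x.
Proof.
move=> fi gi fg; rewrite /Rintegral fine_le//; [exact: integrable_fin_num..|].
by apply: ae_le_integral; [exact: measurable_int fi|exact: measurable_int gi|].
Qed.

Lemma integrable_EFinD (f g : T -> R) :
  mu.-integrable setT (EFin \o f) -> mu.-integrable setT (EFin \o g) ->
  mu.-integrable setT (EFin \o (fun x => f x + g x)).
Proof. by move=> fi gi; exact: (@integrableD _ _ _ mu _ _ (EFin \o f) (EFin \o g)). Qed.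

Lemma integrable_EFinB (f g : T -> R) :
  mu.-integrable setT (EFin \o f) -> mu.-integrable setT (EFin \o g) ->
  mu.-integrable setT (EFin \o (fun x => f x - g x)).
Proof. by move=> fi gi; exact: (@integrableB _ _ _ mu _ _ (EFin \o f) (EFin \o g)). Qed.

Lemma integrable_EFinZ (k : R) (f : T -> R) :
  mu.-integrable setT (EFin \o f) -> mu.-integrable setT (EFin \o (fun x => k * f x)).
Proof. by move=> fi; exact: (@integrableZl _ _ _ mu _ _ k (EFin \o f)). Qed.

Lemma EFin_Rintegral (f : T -> R) : mu.-integrable setT (EFin \o f) ->
  (\int[mu]_x (f x)%:E = (\int[mu]_x f x)%:E)%E.
Proof. by move=> fi; rewrite /Rintegral fineK//; exact: integrable_fin_num. Qed.

End ae_integral.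

(** * Measurability of vector and matrix fields *)

Section vector_measurability.
Context {d} {T : measurableType d} {R : realType} {l : nat}.
Implicit Types F G : T -> 'rV[R]_l.

Definition measurable_field F : Prop :=
  forall i, measurable_fun setT (fun x => F x 0 i).

Lemma measurable_dot F G : measurable_field F -> measurable_field G ->
  measurable_fun setT (fun x => dot (F x) (G x)).
Proof.
move=> mF mG; rewrite /dot.
by apply: measurable_sum => i; exact: measurable_funM.
Qed.

Lemma measurable_enorm F : measurable_field F ->
  measurable_fun setT (fun x => enorm (F x)).
Proof.
move=> mF; rewrite (_ : (fun _ => _) = fun x => (dot (F x) (F x)) `^ (2^-1)).
  apply: (@measurableT_comp _ _ _ _ _ _ (@powR R ^~ 2^-1)).
    exact: measurable_powR.
  exact: measurable_dot.
by apply/funext => x; rewrite powR12_sqrt// dot_ge0.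
Qed.

Lemma measurable_fieldB F G : measurable_field F -> measurable_field G ->
  measurable_field (fun x => F x - G x).
Proof.
move=> mF mG i; under eq_fun do rewrite !mxE; exact: measurable_funB.
Qed.

Lemma measurable_fieldZ (k : T -> R) F : measurable_fun setT k ->
  measurable_field F -> measurable_field (fun x => k x *: F x).
Proof.
move=> mk mF i; under eq_fun do rewrite !mxE; exact: measurable_funM.
Qed.

Lemma measurable_field_mulmx F (P : T -> 'M[R]_l) : measurable_field F ->
  (forall i j, measurable_fun setT (fun x => P x i j)) ->
  measurable_field (fun x => F x *m P x).
Proof.
move=> mF mP i; under eq_fun do rewrite !mxE.
apply: measurable_sum => j; exact: measurable_funM.
Qed.

Lemma measurable_mxtrace (P : T -> 'M[R]_l) :
  (forall i j, measurable_fun setT (fun x => P x i j)) ->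
  measurable_fun setT (fun x => \tr (P x)).
Proof. by move=> mP; rewrite /mxtrace; apply: measurable_sum. Qed.

End vector_measurability.

Lemma continuous_measurable_field {R : realType} {l : nat}
    {F : 'rV[R]_l -> 'rV[R]_l} :
  continuous F -> measurable_field (F : borel R l -> 'rV[R]_l).
Proof.
move=> cF i; apply: (@continuous_measurable_rV _ _ (fun x => F x 0 i)).
move=> x; have := continuous_comp (cF x) (@coord_continuous R 1 l 0 i (F x)).
exact.
Qed.

Lemma hausdorff0 {R : realType} {l n : nat} : (hausdorff n (@set0 'rV[R]_l) <= 0)%E.
Proof.
apply: ge_ereal_sup => _ [e _ <-]; apply: ereal_inf_lbound.
exists (fun _ => set0); first by split.
rewrite eseries0// => k _ _; rewrite /hausdorff_gauge.
by case: asboolP.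
Qed.

(** * A common ball for all times *)

Section flow_support.
Context {R : realType} {l n : nat}.

(** The space-time track over [[a, b]] is compact, hence bounded in sup norm by some [N]; in squared
    Euclidean length this becomes [l * N ^+ 2]. *)
Lemma smooth_compact_flow_support {I : set R} {M : R -> set 'rV[R]_l}
    {mu : R -> {measure set (borel R l) -> \bar R}} {a b : R} :
  smooth_compact_flow n I M -> (forall t, I t -> area_measure n (M t) (mu t)) ->
  (forall u, a <= u <= b -> I u) -> a <= b ->
  exists2 rho : R, 0 <= rho & forall u, a <= u <= b -> mu u [set x | rho < quad 0
      x] = 0%E.
Proof.
move=> [_ cM] mM abI ab.
have Ia : I a by apply: abI; rewrite lexx.
have Ib : I b by apply: abI; rewrite lexx ab.
have [B [_ BP]] := compact_bounded (cM a b Ia Ib).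
pose N := `|B| + 1.
have NP := BP N (lt_le_trans (ltr_pwDr ltr01 (ler_norm B)) (lexx _)).
exists (l%:R * N ^+ 2) => [|u uab]; first by rewrite mulr_ge0 ?sqr_ge0.
apply/eqP; rewrite eq_le measure_ge0 andbT.
rewrite (mM _ (abI _ uab)); last exact: measurable_quad_gt.
rewrite (_ : _ `&` _ = set0); first exact: hausdorff0.
apply/seteqP; split => // x [/= xq Mx].
have /= := NP (u, x) (conj uab Mx).
rewrite prod_normE/= ge_max => /andP[_ xN].
have := quad_le_sqr_norm x; rewrite leNgt => /negP; apply.
apply: le_lt_trans xq; apply: ler_wpM2l => //.
by rewrite lerXn2r ?nnegrE// (le_trans _ xN).
Qed.

End flow_support.

(** * Gaussian test functions *)

Lemma dot_mulmx_row {R : realType} {l : nat} (w y : 'rV[R]_l) (P : 'M[R]_l) :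
  dot w (y *m P) = \sum_i dot w (row i P) * y 0 i.
Proof.
rewrite /dot; under eq_bigr do rewrite mxE mulr_sumr.
rewrite exchange_big/=; apply: eq_bigr => i _.
rewrite mulr_suml; apply: eq_bigr => j _; rewrite !mxE; ring.
Qed.

Section gradient.
Context {R : realType} {l : nat} (c : 'rV[R]_l).
Context {a a' b b' : R -> R}.
Hypotheses (ha : has_C1_derivative a a') (hb : has_C1_derivative b b').

Definition grad_bump (x : 'rV[R]_l) : 'rV[R]_l :=
  (2 * a' (quad 0 x) * b (quad c x)) *: (x - 0)
  + (2 * a (quad 0 x) * b' (quad c x)) *: (x - c).

Lemma derive_bump_dot x v : 'D_v (bump_fun c a b) x = dot (grad_bump x) v.
Proof. by rewrite (derive_bump c ha hb) [RHS]dotDl ![in RHS]dotZl. Qed.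

Lemma grad_bumpE x : grad (bump_fun c a b) x = grad_bump x.
Proof. by apply/rowP => i; rewrite mxE derive_bump_dot dot_delta. Qed.

Lemma measurable_bump : measurable_fun setT (bump_fun c a b : borel R l -> R).
Proof.
apply: continuous_measurable_rV => x; apply: differentiable_continuous.
exact: differentiable_bump ha hb x.
Qed.

Lemma measurable_grad_bump : measurable_field (grad_bump : borel R l -> 'rV[R]_l).
Proof.
move=> i; rewrite (_ : (fun _ => _) = @dbump _ _ c a a' b b' ^~ (delta_mx 0 i)).
  apply: continuous_measurable_rV; exact: continuous_dbump.
by apply/funext => x; rewrite -dot_delta [LHS]dotDl ![in LHS]dotZl.
Qed.


(** Product rule: the position field [x - c] has the identity as derivative and contributes the
    trace of [P]. *)
Lemma div_along_radial_field (P : 'M[R]_l) x :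
  div_along P (@radial_field _ _ c a b) x =
  dot (grad_bump x) ((x - c) *m P) + bump_fun c a b x * \tr P.
Proof.
have dX := differentiable_radial_field c ha hb x.
rewrite /div_along {1}/mxtrace.
transitivity (\sum_i (dot (grad_bump x) (row i P) * (x - c) 0 i + bump_fun c a b x
    * P i i)).
  apply: eq_bigr => i _.
  rewrite -[LHS](_ : row i (P *m jacobian (@radial_field _ _ c a b) x) 0 i = _);
      last by rewrite mxE.
  rewrite row_mul -deriveEjacobian// (derive_radial_field c ha hb) -(derive_bump c
      ha hb) derive_bump_dot.
  by rewrite !mxE.
rewrite big_split/= -mulr_sumr; congr (_ + _).
by rewrite dot_mulmx_row.
Qed.

End gradient.

Section gaussian_profile.
Context {R : realType}.
Implicit Types sigma alpha beta : R.

(** An affine function times a Gaussian. This class is closed under d/dq and contains both the heat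
    kernel ([beta = 0]) and its time derivative. *)
Definition gprofile sigma alpha beta (q : R) : R :=
  (alpha + beta * q) * expR (- (q / (4 * sigma))).

Lemma gprofile_C1 sigma alpha beta : has_C1_derivative (gprofile sigma alpha beta)
  (gprofile sigma (beta - alpha / (4 * sigma)) (- (beta / (4 * sigma)))).
Proof.
have D s k m (q : R) : is_derive q 1 (gprofile s k m)
    (gprofile s (m - k / (4 * s)) (- (m / (4 * s))) q).
  have d1 : is_derive q 1 (fun q : R => k + m * q) (0 + m * 1).
    apply: is_deriveD; exact: is_deriveZ.
  have d2 : is_derive q 1 (fun q : R => - (q / (4 * s))) (- ((4 * s)^-1)).
    apply: is_deriveN.
    rewrite (_ : (fun q : R => q / (4 * s)) = ((4 * s)^-1 *: id)); last first.
      by apply/funext => y; rewrite mulrC.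
    by rewrite -[X in is_derive _ _ _ X](mulr1); exact: is_deriveZ.
  have d3 := @is_derive1_comp _ expR _ q _ _ (is_derive_expR _) d2.
  have d4 := is_deriveM d1 d3.
  suff <- : (fun q : R => k + m * q) q *: (expR (- (q / (4 * s))) * - (4 * s)^-1)
      + (expR \o (fun q : R => - (q / (4 * s)))) q *: (0 + m * 1) =
      gprofile s (m - k / (4 * s)) (- (m / (4 * s))) q by exact: d4.
  by rewrite /gprofile /GRing.scale/=; ring.
split=> [q|q]; first exact: D.
apply: differentiable_continuous; apply/derivable1_diffP.
by case: (D sigma (beta - alpha / (4 * sigma)) (- (beta / (4 * sigma))) q).
Qed.

End gaussian_profile.

(** * Pointwise inequalities *)

Section pointwise.
Context {R : realType} {l : nat}.

Lemma dot_le_half (x y : 'rV[R]_l) : `|dot x y| <= (dot x x + dot y y) / 2.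
Proof.
have := dot_ge0 (x - y); have := dot_ge0 (x + y).
rewrite !dotE (dotC y x) ler_norml; lra.
Qed.

(* Completing the square in [h] and using [K r <= e r^2 + K^2 / (4 e)] with
   e = 1 / (4 p). *)
Lemma brakke_integrand_le (p K : R) (g h : 'rV[R]_l) : 0 < p ->
  - (p * enorm h ^+ 2) + dot g h + K * enorm (g - p *: h)
    <= dot g g / p + K ^+ 2 * p.
Proof.
move=> p0; rewrite sqr_enorm.
set r := enorm _.
have rr : r ^+ 2 = dot g g - 2 * p * dot g h + p ^+ 2 * dot h h.
  by rewrite sqr_enorm !dotE (dotC h g); ring.
have H1 : K * r <= r ^+ 2 / (4 * p) + K ^+ 2 * p.
  rewrite -subr_ge0 (_ : _ - _ = (r / 2 - K * p) ^+ 2 / p).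
    by rewrite divr_ge0 ?sqr_ge0// ltW.
  by field; lra.
apply: le_trans (lerD (lexx _) H1) _.
have H2 := dot_ge0 (g - p *: h); have H3 := dot_ge0 g.
rewrite rr -subr_ge0.
rewrite (_ : _ - _ = (3 / 4) * (dot g g / p) - dot g h / 2 + (3 / 4) * p * dot h
    h); last first.
  by field; lra.
rewrite (_ : _ + _ = (dot (g - p *: h) (g - p *: h) / (4 * p) + (dot g g / p + p *
    dot h h) / 2)).
  by rewrite addr_ge0// ?divr_ge0 ?addr_ge0 ?divr_ge0 ?mulr_ge0 ?dot_ge0//; lra.
by rewrite !dotE (dotC h g); field; lra.
Qed.

(* With w = h + y / (2 s) and b = |y P| / (2 s) <= |w|, the left-hand side is
   p (- |w|^2 + b^2 + K |w|) and |w|^2 - b^2 >= (|w| - b)^2. *)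
Lemma huisken_integrand_le (n : nat) (P : 'M[R]_l) (p s K K' : R)
    (y h : 'rV[R]_l) :
  plane_projection n P -> h *m P = 0 -> 0 <= p -> 0 < s -> K <= K' -> 0 <= K' ->
  - (p * enorm h ^+ 2) + dot ((- (p / (2 * s))) *: y) h
    + K * enorm ((- (p / (2 * s))) *: y - p *: h)
  <= p * (K' ^+ 2 / 4 + K' * (enorm y / (2 * s)))
     - (p * (- (dot y y / (4 * s ^+ 2)) + dot y (y *m P) / (4 * s ^+ 2))
        + dot h ((- (p / (2 * s))) *: y)).
Proof.
pose w := h + (2 * s)^-1 *: y; move=> hP hP0.
have wP : w *m P = (2 * s)^-1 *: (y *m P).
  by rewrite mulmxDl hP0 add0r -scalemxAl.
have {hP0 wP} : dot ((2 * s)^-1 *: (y *m P)) ((2 * s)^-1 *: (y *m P)) <= dot w w.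
  by rewrite -wP; exact: dot_projection_le hP.
rewrite !(dotZl, dotZr) (dot_projection _ _ _ hP) => wP p0 s0 KK K0.
have -> : (- (p / (2 * s))) *: y - p *: h = (- p) *: w.
  by rewrite /w scalerDr scalerA mulNr !scaleNr addrC.
rewrite enormZ normrN (ger0_norm p0).
set r := enorm w; pose B := enorm (y *m P) / (2 * s).
have r0 : 0 <= r := enorm_ge0 _.
have B0 : 0 <= B by rewrite divr_ge0 ?enorm_ge0//; lra.
have rr : r ^+ 2 = dot h h + dot y h / s + dot y y / (4 * s ^+ 2).
  by rewrite sqr_enorm /w !dotE (dotC h y); field; lra.
have BB : B ^+ 2 = dot y (y *m P) / (4 * s ^+ 2).
  by rewrite /B expr_div_n sqr_enorm (dot_projection _ _ _ hP); field; lra.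
have Br : B <= r.
  rewrite -(ler_pXn2r (ltn0Sn 1)) ?nnegrE// BB sqr_enorm; apply: le_trans wP.
  by rewrite le_eqVlt; apply/orP; left; apply/eqP; field; lra.
have By : B <= enorm y / (2 * s).
  apply: ler_wpM2r; first by rewrite invr_ge0; lra.
  by rewrite /enorm ler_wsqrtr// (dot_projection_le n).
rewrite sqr_enorm (dotC h y) -subr_ge0.
rewrite (_ : _ - _ = p * (K' ^+ 2 / 4 + K' * (enorm y / (2 * s)) + r ^+ 2 - B ^+ 2
    - K * r)); last first.
  by rewrite rr BB; field; lra.
apply: mulr_ge0 => //.
have := sqr_ge0 (r - B - K' / 2).
have := ler_wpM2l K0 By; have := ler_wpM2r r0 KK.
have : 0 <= B * (r - B) by rewrite mulr_ge0//; lra.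
nra.
Qed.

(** Half of the exponent absorbs the linear factor. With z = sqrt q / (2 sqrt s) this is z exp(- z^2
    / 2) <= 1, which follows from exp(z^2 / 2) >= 1 + z^2 / 2 >= z; the other half is the Gaussian
    at scale 2 s. *)
Lemma gaussian_first_moment (s q : R) : 0 < s -> 0 <= q ->
  expR (- (q / (4 * s))) * (Num.sqrt q / (2 * s))
    <= (Num.sqrt s)^-1 * expR (- (q / (4 * (2 * s)))).
Proof.
move=> s0 q0.
have ss0 : 0 < Num.sqrt s by rewrite sqrtr_gt0.
have sE : s = Num.sqrt s ^+ 2 by rewrite sqr_sqrtr// ltW.
have qE : q = Num.sqrt q ^+ 2 by rewrite sqr_sqrtr.
have -> : - (q / (4 * s)) = - (q / (4 * (2 * s))) - q / (8 * s) by field; lra.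
rewrite expRD -mulrA [leRHS]mulrC ler_wpM2l ?expR_ge0//.
set z := Num.sqrt q / (2 * Num.sqrt s).
have -> : Num.sqrt q / (2 * s) = z / Num.sqrt s.
  by rewrite /z {1}sE; field; rewrite gt_eqF.
have -> : - (q / (8 * s)) = - (z ^+ 2 / 2).
  by rewrite /z {1}sE {1}qE; field; rewrite gt_eqF.
rewrite mulrA ler_piMl ?invr_ge0 ?sqrtr_ge0//.
rewrite expRN mulrC ler_pdivrMr ?expR_gt0// mul1r.
apply: le_trans (expR_ge1Dx (z ^+ 2 / 2)).
have := sqr_ge0 (z - 1); nra.
Qed.

End pointwise.

(** * The right-hand side of the Brakke inequality *)

Section brakke_bounds.
Context {R : realType} {l : nat} (n : nat) (rho V : R) (c : 'rV[R]_l).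
Context {mu : {measure set (borel R l) -> \bar R}}.
Hypotheses (muV : (mu setT <= V%:E)%E) (mu_rho : mu [set x | rho < quad 0 x] = 0%E).

Lemma ae_quad_le : {ae mu, forall x, quad 0 x <= rho}.
Proof.
exists [set x | rho < quad 0 x]; split => //; first exact: measurable_quad_gt.
by move=> x /= /negP; rewrite -ltNge.
Qed.

Lemma mass_lty : (mu setT < +oo)%E.
Proof. by apply: le_lt_trans muV _; rewrite ltry. Qed.

Lemma integral_cst_le (B : R) : 0 <= B -> (\int[mu]_x B%:E <= (B * V)%:E)%E.
Proof.
by move=> B0; rewrite integral_cst// EFinM; apply: lee_wpmul2l.
Qed.

Section cutoff_profile.
Context {b b' : R -> R} (hb : has_C1_derivative b b').

Lemma bump_cutoff x : quad 0 x <= rho -> bump_fun c (cutoff rho) b x = b (quad c x).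
Proof. by move=> xrho; rewrite /bump_fun cutoff1// mul1r. Qed.

Lemma grad_bump_cutoff x : quad 0 x <= rho ->
  @grad_bump _ _ c (cutoff rho) (dcutoff rho) b b' x = (2 * b' (quad c x)) *: (x - c).
Proof.
by move=> xrho; rewrite /grad_bump dcutoff0// cutoff1// mulr0 mul0r scale0r add0r mulr1.
Qed.

Lemma measurable_brakke_integrand (K : R) (H : borel R l -> 'rV[R]_l) :
  measurable_field H ->
  measurable_fun setT (fun x : borel R l =>
    - (bump_fun c (cutoff rho) b x * enorm (H x) ^+ 2)
    + dot (grad (bump_fun c (cutoff rho) b) x) (H x)
    + K * enorm (grad (bump_fun c (cutoff rho) b) x - bump_fun c (cutoff rho) b x
        *: H x)).
Proof.
move=> mH.
have mphi := measurable_bump c (cutoff_C1 rho) hb.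
have mg : measurable_field (grad (bump_fun c (cutoff rho) b) : borel R l -> 'rV[R]_l).
  move=> i; have := measurable_grad_bump c (cutoff_C1 rho) hb i.
  by under eq_fun do rewrite -(grad_bumpE c (cutoff_C1 rho) hb).
apply: measurable_funD; first apply: measurable_funD.
- apply: measurableT_comp => //; apply: measurable_funM => //.
  by apply: measurable_funX; exact: measurable_enorm.
- exact: measurable_dot.
- apply: measurable_funM => //; apply: measurable_enorm.
  by apply: measurable_fieldB => //; exact: measurable_fieldZ.
Qed.

(** A crude bound from completing the square. Where the cutoff is 1, |grad phi|^2 / phi equals 4
    b'^2 q / b at q = |x - c|^2. *)
Lemma brakke_rhs_le_cst (K B : R) : 0 <= B ->
  (forall x, quad 0 x <= rho -> 0 < b (quad c x)) ->
  (forall x, quad 0 x <= rho ->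
     4 * b' (quad c x) ^+ 2 * quad c x / b (quad c x) + K ^+ 2 * b (quad c x) <= B) ->
  (brakke_rhs n K mu (bump_fun c (cutoff rho) b) <= (B * V)%:E)%E.
Proof.
move=> B0 b0 bB; apply: ge_ereal_sup => _ [H [mH _ _] <-].
apply: le_trans (integral_cst_le B B0); apply: ae_le_integral => //.
  by apply/measurable_EFinP; exact: measurable_brakke_integrand.
apply: ae_imp ae_quad_le => x xrho; rewrite lee_fin.
rewrite (grad_bumpE c (cutoff_C1 rho) hb) grad_bump_cutoff// bump_cutoff//.
apply: le_trans (brakke_integrand_le _ _ _ _ (b0 x xrho)) _.
apply: le_trans (bB x xrho); rewrite dotZl dotZr -/(quad c x).
by rewrite le_eqVlt; apply/orP; left; apply/eqP; ring.
Qed.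

End cutoff_profile.

(** By the parallelogram law, |x - c|^2 + |x + c|^2 = 2 |x|^2 + 2 |c|^2. *)
Lemma quad_le_ball x : quad 0 x <= rho -> quad c x <= 2 * (rho + quad 0 c).
Proof.
rewrite /quad !subr0 => xrho; have := dot_ge0 (x + c).
by rewrite !dotE (dotC c x); lra.
Qed.

(** Local square integrability is global here, because [mu] is carried by a compact ball. *)
Lemma mean_curvature_integrable (H : borel R l -> 'rV[R]_l) :
  mean_curvature n mu H ->
  mu.-integrable setT (EFin \o (fun x => dot (H x) (H x))).
Proof.
move=> [mH HC _].
have mHH : measurable_fun setT (fun x : borel R l => (dot (H x) (H x))%:E).
  by apply/measurable_EFinP; exact: measurable_dot.
have mN := measurable_quad_gt (0 : 'rV[R]_l) rho.
apply/(negligible_integrable mN measurableT mHH mu_rho)/integrableP; split.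
  exact: measurable_funS mHH.
apply: le_lt_trans (HC _ (compact_quad_le rho)).
rewrite (_ : setT `\` _ = [set x | quad 0 x <= rho]); last first.
  apply/seteqP; split => x /=; first by move=> [_ /negP]; rewrite -leNgt.
  by move=> xrho; split => //; apply/negP; rewrite -leNgt.
rewrite le_eqVlt; apply/orP; left; apply/eqP; apply: eq_integral => x _ /=.
by rewrite sqr_enorm ger0_norm// dot_ge0.
Qed.

Lemma ae_normal_plane {H : borel R l -> 'rV[R]_l} {P : borel R l -> 'M[R]_l} :
  tangent_field n mu P -> {ae mu, forall x, H x *m P x = 0} ->
  {ae mu, forall x, [/\ quad 0 x <= rho, plane_projection n (P x) & H x *m P x = 0]}.
Proof.
move=> [_ tP] HP; apply: ae_imp (ae_and ae_quad_le (ae_and tP HP)) => x.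
by move=> [? [[? _] ?]].
Qed.

End brakke_bounds.

Section gaussian_bound.
Context {R : realType} {l : nat} (n : nat) (rho V : R) (c : 'rV[R]_l).
Context {mu : {measure set (borel R l) -> \bar R}}.
Hypotheses (muV : (mu setT <= V%:E)%E) (mu_rho : mu [set x | rho < quad 0 x] = 0%E).

Definition gauss (s : R) (x : 'rV[R]_l) : R := expR (- (quad c x / (4 * s))).

Lemma gauss_le1 s x : 0 < s -> gauss s x <= 1.
Proof.
move=> s0; rewrite /gauss -[leRHS]expR0 ler_expR oppr_le0 divr_ge0 ?quad_ge0//; lra.
Qed.

Lemma measurable_gauss s : measurable_fun setT (gauss s : borel R l -> R).
Proof.
apply: (@measurableT_comp _ _ _ _ _ _ (@expR R)); first exact: measurable_expR.
apply: (@measurableT_comp _ _ _ _ _ _ (@GRing.opp R)); first exact: oppr_measurable.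
apply: measurable_funM => //; apply: continuous_measurable_rV.
exact: continuous_quad.
Qed.

Lemma integrable_gauss s : 0 < s -> mu.-integrable setT (EFin \o gauss s).
Proof.
move=> s0; apply: (ae_bounded_integrable _ 1).
- exact: mass_lty muV.
- exact: measurable_gauss.
- by apply: aeW => x; rewrite ger0_norm ?expR_ge0// gauss_le1.
Qed.

Lemma integrable_bump_gprofile s alpha beta : 0 < s ->
  mu.-integrable setT (EFin \o bump_fun c (cutoff rho) (gprofile s alpha beta)).
Proof.
move=> s0; apply: (ae_bounded_integrable _ (`|alpha| + `|beta| * (2 * (rho + quad 0
    c)))).
- exact: mass_lty muV.
- by have := measurable_bump c (cutoff_C1 rho) (gprofile_C1 s alpha beta).
- apply: ae_imp (ae_quad_le _ mu_rho) => x xrho.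
  rewrite bump_cutoff// /gprofile normrM (ger0_norm (expR_ge0 _)).
  apply: le_trans (ler_wpM2l (normr_ge0 _) (gauss_le1 s x s0)) _.
  rewrite mulr1; apply: le_trans (ler_normD _ _) _; rewrite lerD2l normrM.
  by rewrite ler_wpM2l// ger0_norm ?quad_ge0// quad_le_ball.
Qed.

(** Huisken's computation at a fixed time. The integral subtracted at the end is, for [kappa] the
    heat kernel constant, that of the time derivative of the kernel, and will cancel once the kernel
    moves. [K'] is a nonnegative upper bound for [K], whose sign is free. *)
Lemma brakke_rhs_gaussian (s kappa K K' : R) :
  0 < s -> 0 <= kappa -> K <= K' -> 0 <= K' ->
  (brakke_rhs n K mu (bump_fun c (cutoff rho) (gprofile s kappa 0))
   <= (kappa * (K' ^+ 2 / 4) * \int[mu]_x gauss s x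
       + kappa * K' / Num.sqrt s * \int[mu]_x gauss (2 * s) x
       - \int[mu]_x bump_fun c (cutoff rho)
           (gprofile s (kappa * (n%:R / (2 * s))) (- (kappa / (4 * s ^+ 2)))) x)%:E)%E.
Proof.
move=> s0 kappa0 KK K0; apply: ge_ereal_sup => _ [H mcH <-].
have iHH := mean_curvature_integrable n rho mu_rho H mcH.
case: mcH => mH _ [P tP [HP firstvar]].
have aeD := ae_normal_plane n rho mu_rho tP HP.
set b := gprofile s kappa 0.
set psi := bump_fun c (cutoff rho) (gprofile s (kappa * (n%:R / (2 * s))) (- (kappa
    / (4 * s ^+ 2)))).
(* The factor makes [X] the gradient of the Gaussian on the ball: that gradient is 2 b'(q) (x - c),
   and 2 b' = - b / (2 s). *)
pose bX := gprofile s (- (kappa / (2 * s))) 0.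
pose X := @radial_field _ _ c (cutoff rho) bX.
have hb : has_C1_derivative b _ := gprofile_C1 s kappa 0.
pose bX' := gprofile s (0 - - (kappa / (2 * s)) / (4 * s)) (- (0 / (4 * s))).
have hX : has_C1_derivative bX bX' := gprofile_C1 s (- (kappa / (2 * s))) 0.
have ipsi : mu.-integrable setT (EFin \o psi) by exact: integrable_bump_gprofile.
pose Q := 2 * (rho + quad 0 c).
have divX x : quad 0 x <= rho -> plane_projection n (P x) ->
    div_along (P x) X x = kappa * gauss s x *
      (dot (x - c) ((x - c) *m P x) / (4 * s ^+ 2) - n%:R / (2 * s)).
  move=> xrho [PT PP rP].
  rewrite (div_along_radial_field c (cutoff_C1 rho) hX) grad_bump_cutoff//.
  rewrite bump_cutoff// (mxtrace_idempotent _ PP) rP dotZl /bX' /bX /gprofile /gauss.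
  by field; lra.
have XE x : quad 0 x <= rho -> X x = (- (kappa * gauss s x / (2 * s))) *: (x - c).
  move=> xrho; rewrite /X /radial_field bump_cutoff// /bX /gprofile mul0r addr0.
  by congr (_ *: _); rewrite mulNr mulrAC.
have mdiv : measurable_fun setT (fun x : borel R l => div_along (P x) X x).
  rewrite (_ : (fun _ => _) = fun x : borel R l =>
     dot (@grad_bump _ _ c (cutoff rho) (dcutoff rho) bX bX' x) ((x - c) *m P x)
     + bump_fun c (cutoff rho) bX x * \tr (P x)); last first.
    by apply/funext => x; exact: (div_along_radial_field c (cutoff_C1 rho) hX).
  apply: measurable_funD.
    apply: measurable_dot; first exact: (measurable_grad_bump c (cutoff_C1 rho) hX).
    apply: measurable_field_mulmx; last by case: tP.
    apply: (@continuous_measurable_field _ _ (fun x => x - c)) => x.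
    exact: cvgB cvg_id (cvg_cst c).
  apply: measurable_funM; first exact: (measurable_bump c (cutoff_C1 rho) hX).
  by apply: measurable_mxtrace; case: tP.
have kg x : 0 <= kappa * gauss s x <= kappa.
  rewrite mulr_ge0 ?expR_ge0//= -[leRHS]mulr1 ler_wpM2l//; exact: gauss_le1.
have idiv : mu.-integrable setT (EFin \o (fun x => div_along (P x) X x)).
  apply: (ae_bounded_integrable _ (kappa * (Q / (4 * s ^+ 2) + n%:R / (2 * s)))).
  - exact: mass_lty muV.
  - exact: mdiv.
  apply: ae_imp aeD => x [xrho hP _]; rewrite divX// normrM.
  have /andP[kg0 kg1] := kg x; rewrite (ger0_norm kg0) ler_pM//.
  apply: le_trans (ler_normB _ _) _.
  have d0 : 0 <= dot (x - c) ((x - c) *m P x) by rewrite -(dot_projection _ _ _ hP)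
      dot_ge0.
  rewrite !ger0_norm ?divr_ge0 ?mulr_ge0 ?sqr_ge0 ?ler0n//; try lra.
  rewrite lerD2r ler_wpM2r ?invr_ge0 ?mulr_ge0 ?sqr_ge0 ?(ltW s0)//.
  apply: le_trans _ (quad_le_ball _ _ _ xrho); rewrite -(dot_projection _ _ _ hP).
  exact: dot_projection_le hP.
have mX : measurable_field (X : borel R l -> 'rV[R]_l).
  apply: continuous_measurable_field => x; apply: differentiable_continuous.
  exact: (differentiable_radial_field c (cutoff_C1 rho) hX).
(* Dominated by (|H|^2 + |X|^2) / 2, with |H|^2 integrable and |X| bounded on the ball. *)
have iHX : mu.-integrable setT (EFin \o (fun x => dot (H x) (X x))).
  pose M := (kappa / (2 * s)) ^+ 2 * Q.
  apply: (ae_le_integrable _ (fun x => 2^-1 * dot (H x) (H x) + 2^-1 * M)).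
  - exact: measurable_dot.
  - apply: integrable_EFinD; first exact: integrable_EFinZ.
    apply: (ae_bounded_integrable _ `|2^-1 * M|);
        [exact: mass_lty muV | by [] | exact: aeW].
  apply: ae_imp aeD => x [xrho _ _].
  apply: le_trans (dot_le_half _ _) _.
  suff : dot (X x) (X x) <= M by lra.
  rewrite XE// dotZl dotZr mulrA -expr2 sqrrN.
  rewrite ler_pM ?sqr_ge0 ?dot_ge0//; last exact: quad_le_ball.
  have /andP[kg0 kg1] := kg x.
  rewrite lerXn2r ?nnegrE ?divr_ge0//; try lra.
  by rewrite ler_wpM2r// invr_ge0; lra.
have FV : \int[mu]_x div_along (P x) X x = - \int[mu]_x dot (H x) (X x).
  apply: firstvar; first exact: (Ck_radial_field c (cutoff_C1 rho) hX).
  apply: (@compactly_supported_of_quad _ _ _ _ (rho + 1)) => x rhox.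
  by rewrite /X /radial_field /bump_fun cutoff0 ?(ltW rhox)// mul0r scale0r.
have ig := integrable_gauss s s0.
have ig2 : mu.-integrable setT (EFin \o gauss (2 * s)) by apply: integrable_gauss; lra.
set k1 := kappa * (K' ^+ 2 / 4); set k2 := kappa * K' / Num.sqrt s.
have i1 := integrable_EFinZ k1 _ ig; have i2 := integrable_EFinZ k2 _ ig2.
have i3 := integrable_EFinD _ _ i1 i2; have i4 := integrable_EFinD _ _ idiv iHX.
have i5 := integrable_EFinB _ _ i3 ipsi; have i6 := integrable_EFinB _ _ i5 i4.
rewrite -RintegralZl// -RintegralZl// -RintegralD// -RintegralB//.
(* The first variation identity is inserted as a vanishing integral, which leaves a comparison of
   integrands almost everywhere. *)
rewrite -[X in X%:E]subr0 (_ : 0 = \int[mu]_x (div_along (P x) X x + dot (H x) (X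
    x))); last first.
  by rewrite RintegralD// FV addNr.
rewrite -RintegralB// -EFin_Rintegral//.
apply: ae_le_integral.
- apply/measurable_EFinP.
  exact: (measurable_brakke_integrand rho c hb K H mH).
- exact: measurable_int i6.
apply: ae_imp aeD => x [xrho hP HPx]; rewrite lee_fin /=.
rewrite (grad_bumpE c (cutoff_C1 rho) hb) grad_bump_cutoff// bump_cutoff//.
have -> : 2 * gprofile s (0 - kappa / (4 * s)) (- (0 / (4 * s))) (quad c x) =
    - (kappa * gauss s x / (2 * s)).
  by rewrite /gprofile /gauss; field; lra.
have -> : b (quad c x) = kappa * gauss s x by rewrite /b /gprofile /gauss; ring.
have /andP[kg0 _] := kg x.
apply: le_trans (huisken_integrand_le _ _ _ _ _ _ _ _ hP HPx kg0 s0 KK K0) _.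
rewrite divX// XE// /psi bump_cutoff//.
have := gaussian_first_moment s (quad c x) s0 (quad_ge0 c x).
rewrite -/(gauss s x) -/(gauss (2 * s) x) -/(enorm (x - c)) => gm.
have := ler_wpM2l (mulr_ge0 kappa0 K0) gm.
rewrite (_ : gprofile _ _ _ _ = kappa * gauss s x * (n%:R / (2 * s) - dot (x - c)
    (x - c) / (4 * s ^+ 2))); last first.
  by rewrite /gprofile /gauss /quad; field; lra.
rewrite /k1 /k2; lra.
Qed.

End gaussian_bound.

(** * Time derivative of the heat kernel *)

Section time_expansion.
Context {R : realType}.
Implicit Types (E F : R -> R) (u h z : R).

Lemma is_derive_expansion {E u} {E' e : R} : is_derive u 1 E E' -> 0 < e ->
  exists2 d, 0 < d & forall h, `|h| < d -> `|E (u + h) - E u - h * E'| <= e * `|h|.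
Proof.
move=> [dE EE'] e0.
have /cvgrPdist_le /(_ _ e0) : (fun h => h^-1 *: (E (h *: 1 + u) - E u)) @ 0^' --> E'.
  by rewrite -EE'; exact: dE.
move=> /nbhs_ballP[d /= d0 dP]; exists d => // h hd.
have [->|h0] := eqVneq h 0; first by rewrite addr0 subrr mul0r subr0 normr0 mulr0.
have : `|E' - h^-1 *: (E (h *: 1 + u) - E u)| <= e.
  by apply: dP => //; rewrite /ball/= sub0r normrN.
rewrite /GRing.scale/= mulr1 [h + u]addrC => H.
rewrite (_ : _ - _ - _ = - (h * (E' - h^-1 * (E (u + h) - E u)))); last by field.
by rewrite normrN normrM mulrC ler_wpM2r.
Qed.

(** The exponential lies between 1 + z and 1 / (1 - z), and the latter is at most 1 + z + 2 z^2 for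
    z <= 1/2. *)
Lemma expR_taylor1 z : `|z| <= 1 / 2 -> `|expR z - 1 - z| <= 2 * z ^+ 2.
Proof.
rewrite ler_norml => /andP[z1 z2].
rewrite ger0_norm; last by have := expR_ge1Dx z; lra.
have : expR z <= (1 - z)^-1.
  rewrite -[expR z]invrK -expRN lef_pV2 ?posrE ?expR_gt0//; last lra.
  by have := expR_ge1Dx (- z); lra.
have : (1 - z)^-1 <= 1 + z + 2 * z ^+ 2.
  rewrite -[_^-1]mul1r ler_pdivrMr; last lra.
  by nra.
lra.
Qed.

(** The radius [d] is uniform in [q], so that the expansion can be integrated in space. The
    increment of the exponent is affine in [q], hence controlled through [Q] alone. *)
Lemma expR_affine_expansion {E F u} {E' F' : R} (Q e : R) :
  is_derive u 1 E E' -> is_derive u 1 F F' -> 0 <= Q -> 0 < e ->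
  exists2 d, 0 < d & forall h, `|h| < d -> forall q, 0 <= q <= Q ->
    `|expR (E (u + h) + q * F (u + h)) - expR (E u + q * F u)
      - h * ((E' + q * F') * expR (E u + q * F u))| <= e * `|h|.
Proof.
move=> dE dF Q0 e0.
(* [M] bounds the exponential at time [u] and [W] exceeds |E' + q F'| by at least 1. Then [e1]
   limits the error of the exponent to [e / (2 M)] per unit of [|h|], and [d3] ensures |z| <= 1/2
   and a quadratic remainder 2 M W^2 h^2 of at most [e / 2 * |h|]. *)
pose M := expR (`|E u| + Q * `|F u|); have M0 : 0 < M by exact: expR_gt0.
pose W := `|E'| + Q * `|F'| + 1.
have W0 : 0 < W.
  by rewrite /W; have := normr_ge0 E'; have := mulr_ge0 Q0 (normr_ge0 F'); lra.
pose e1 := Num.min 1 (e / (2 * M)) / (1 + Q).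
have e10 : 0 < e1.
  by rewrite divr_gt0 ?lt_min ?ltr01 ?divr_gt0//=; lra.
have e1Q : e1 * (1 + Q) = Num.min 1 (e / (2 * M)) by rewrite /e1 divfK// gt_eqF//; lra.
have [d1 d10 d1P] := is_derive_expansion dE e10.
have [d2 d20 d2P] := is_derive_expansion dF e10.
pose d3 := Num.min (1 / 2 / W) (e / (4 * M * W ^+ 2)).
have MW0 : 0 < 4 * M * W ^+ 2 by rewrite mulr_gt0 ?exprn_gt0// mulr_gt0.
have d30 : 0 < d3.
  rewrite lt_min; apply/andP; split; apply: divr_gt0 => //; lra.
exists (Num.min (Num.min d1 d2) d3); first by rewrite 2!lt_min d10 d20 d30.
move=> h; rewrite lt_min => /andP[]; rewrite lt_min => /andP[hd1 hd2].
rewrite lt_min => /andP[]; rewrite ltr_pdivlMr// => hW.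
rewrite ltr_pdivlMr// => hMW q /andP[q0 qQ].
pose z := (E (u + h) - E u) + q * (F (u + h) - F u).
pose w := E' + q * F'.
have ww : `|w| + 1 <= W.
  rewrite /W lerD2r; apply: le_trans (ler_normD _ _) _.
  by rewrite lerD2l normrM (ger0_norm q0) ler_wpM2r.
have zw : `|z - h * w| <= e1 * (1 + Q) * `|h|.
  rewrite (_ : _ - _ = (E (u + h) - E u - h * E') + q * (F (u + h) - F u - h *
      F')); last by rewrite /z /w; ring.
  apply: le_trans (ler_normD _ _) _; rewrite normrM (ger0_norm q0).
  have H1 := d1P h hd1; have H2 := d2P h hd2.
  have H3 : q * `|F (u + h) - F u - h * F'| <= Q * (e1 * `|h|) by rewrite ler_pM.
  lra.
have e1Q1 : e1 * (1 + Q) <= 1 by rewrite e1Q ge_min lexx.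
have e1Q2 : e1 * (1 + Q) * M <= e / 2.
  rewrite e1Q; apply: le_trans (ler_wpM2r (ltW M0) (_ : _ <= e / (2 * M))) _.
    by rewrite ge_min lexx orbT.
  by rewrite le_eqVlt; apply/orP; left; apply/eqP; field; rewrite gt_eqF.
have zW : `|z| <= `|h| * W.
  rewrite (_ : z = (z - h * w) + h * w); last by ring.
  apply: le_trans (ler_normD _ _) _; rewrite normrM.
  have := ler_wpM2r (normr_ge0 h) e1Q1; have := ler_wpM2l (normr_ge0 h) ww; lra.
have zt : `|expR z - 1 - z| <= 2 * z ^+ 2 by apply: expR_taylor1; lra.
have zz : z ^+ 2 <= (`|h| * W) ^+ 2.
  by rewrite -(real_normK (num_real z)) lerXn2r ?nnegrE// mulr_ge0// ltW.
set G0 := expR (E u + q * F u).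
have G0M : G0 <= M.
  rewrite ler_expR; apply: lerD; first exact: ler_norm.
  by apply: le_trans (ler_norm _) _; rewrite normrM (ger0_norm q0) ler_wpM2r.
have -> : expR (E (u + h) + q * F (u + h)) - G0 - h * (w * G0) =
    G0 * ((expR z - 1 - z) + (z - h * w)).
  rewrite (_ : E (u + h) + q * F (u + h) = (E u + q * F u) + z);
      last by rewrite /z; ring.
  by rewrite expRD -/G0; ring.
rewrite normrM ger0_norm ?expR_ge0//.
apply: le_trans (ler_wpM2r (normr_ge0 _) G0M) _.
apply: le_trans (ler_wpM2l (ltW M0) (ler_normD _ _)) _.
have H1 := ler_wpM2l (ltW M0) (lerD zt zw).
apply: le_trans H1 _.
have H2 := ler_wpM2l (ltW M0) zz.
have H3 := ler_wpM2r (normr_ge0 h) (ltW hMW).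
have H4 := ler_wpM2r (normr_ge0 h) e1Q2.
lra.
Qed.

End time_expansion.

Section gaussian_constant.
Context {R : realType} (n : nat).
Implicit Types s t u : R.

Definition gauss_cst s : R := ((4 * pi * s) `^ (n%:R / 2))^-1.

Lemma gauss_cst_gt0 s : 0 < s -> 0 < gauss_cst s.
Proof.
by move=> s0; rewrite invr_gt0 powR_gt0// !mulr_gt0// pi_gt0.
Qed.

(** The origin of the factor 2^(n/2): Gaussian integrals at scale 2 s appear with the constant of
    scale s. *)
Lemma gauss_cst_double s : 0 < s -> gauss_cst s = 2 `^ (n%:R / 2) * gauss_cst (2 * s).
Proof.
move=> s0; rewrite /gauss_cst (_ : 4 * pi * (2 * s) = 2 * (4 * pi * s)); last by ring.
have ps : 0 <= 4 * pi * s by rewrite !mulr_ge0// ?pi_ge0// ltW.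
rewrite [(2 * _) `^ _]powRM// invfM mulrA divff ?mul1r// gt_eqF// powR_gt0//.
Qed.

Lemma gauss_cst_le s t : 0 < s -> s <= t -> gauss_cst t <= gauss_cst s.
Proof.
move=> s0 st; have p4 : 0 < 4 * pi :> R by rewrite mulr_gt0// pi_gt0.
have s4 : 0 < 4 * pi * s by rewrite mulr_gt0.
have st4 : 4 * pi * s <= 4 * pi * t by rewrite ler_wpM2l// ltW.
have t4 := lt_le_trans s4 st4.
rewrite lef_pV2 ?posrE ?powR_gt0//.
by apply: ge0_ler_powR; rewrite ?nnegrE ?divr_ge0 ?(ltW s4) ?(ltW t4).
Qed.

Lemma gauss_cst_expR s : 0 < s ->
  gauss_cst s = expR (- (n%:R / 2 * ln (4 * pi * s))).
Proof.
move=> s0; rewrite /gauss_cst /powR gt_eqF ?expRN//.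
by rewrite !mulr_gt0// pi_gt0.
Qed.

(** The kernel is exp(E + q F) with E = - (n / 2) ln(4 pi (T0 - u)) and F = - 1 / (4 (T0 - u)),
    whose derivatives in [u] give the affine factor of its time derivative. *)
Lemma gprofile_time_expansion (T0 u Q e : R) : u < T0 -> 0 <= Q -> 0 < e ->
  exists2 d, 0 < d & forall h, `|h| < d -> u + h < T0 -> forall q, 0 <= q <= Q ->
    `|gprofile (T0 - (u + h)) (gauss_cst (T0 - (u + h))) 0 q
      - gprofile (T0 - u) (gauss_cst (T0 - u)) 0 q
      - h * gprofile (T0 - u) (gauss_cst (T0 - u) * (n%:R / (2 * (T0 - u))))
              (- (gauss_cst (T0 - u) / (4 * (T0 - u) ^+ 2))) q| <= e * `|h|.
Proof.
move=> uT Q0 e0; have s0 : 0 < T0 - u by lra.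
have pi4 : 0 < 4 * pi :> R by rewrite mulr_gt0// pi_gt0.
have ds : is_derive u 1 (fun v : R => T0 - v) (- 1).
  by rewrite -[X in is_derive _ _ _ X]sub0r; exact: is_deriveB.
have dE : is_derive u 1 (fun v : R => - (n%:R / 2 * ln (4 * pi * (T0 - v))))
    (n%:R / (2 * (T0 - u))).
  have d1 : is_derive u 1 ((4 * pi) *: (fun v : R => T0 - v)) ((4 * pi) *: (- 1)).
    exact: is_deriveZ.
  have d2 : is_derive (((4 * pi) *: (fun v : R => T0 - v)) u) 1 (@ln R) (4 * pi *
      (T0 - u))^-1.
    by apply: is_derive1_ln; rewrite mulr_gt0.
  have d3 := is_deriveN (is_deriveZ (n%:R / 2) (@is_derive1_comp _ _ _ _ _ _ d2 d1)).
  suff <- : - ((n%:R / 2) *: ((4 * pi * (T0 - u))^-1 * ((4 * pi) *: (- 1)))) = n%:R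
      / (2 * (T0 - u)) by exact: d3.
  rewrite /GRing.scale/=; move: (@pi R) (@pi_gt0 R) => p p0.
  by field; rewrite !gt_eqF.
have dF : is_derive u 1 (fun v : R => - (4 * (T0 - v))^-1) (- (4 * (T0 - u) ^+ 2)^-1).
  have d1 : is_derive u 1 (4 *: (fun v : R => T0 - v)) (4 *: (- 1)).
    exact: is_deriveZ.
  have n0 : (4 *: (fun v : R => T0 - v)) u != 0 by rewrite gt_eqF// mulr_gt0.
  have d2 := is_deriveN (is_deriveV n0 d1).
  suff <- : - (- ((4 *: (fun v : R => T0 - v)) u) ^- 2 *: (4 *: (- 1))) =
    - (4 * (T0 - u) ^+ 2)^-1 :> R by exact: d2.
  by rewrite /GRing.scale/= /GRing.scale_fun/= /GRing.scale/=; field; rewrite gt_eqF.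
have [d d0 dP] := expR_affine_expansion Q e dE dF Q0 e0.
have gE v q : v < T0 -> gprofile (T0 - v) (gauss_cst (T0 - v)) 0 q =
    expR (- (n%:R / 2 * ln (4 * pi * (T0 - v))) + q * (- (4 * (T0 - v))^-1)).
  move=> vT; rewrite /gprofile mul0r addr0 gauss_cst_expR ?subr_gt0// -expRD.
  by rewrite mulrN.
exists d => // h hd uhT q qQ; rewrite !gE//.
have := dP h hd q qQ; rewrite -!gE//.
rewrite (_ : _ * gprofile _ _ 0 _ = gprofile (T0 - u) (gauss_cst (T0 - u) * (n%:R /
    (2 * (T0 - u))))
              (- (gauss_cst (T0 - u) / (4 * (T0 - u) ^+ 2))) q)//.
by rewrite /gprofile; field; lra.
Qed.

End gaussian_constant.

(** * Growth of the Gaussian areas along the flow *)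

(** Provides the finite bounds that [dini_le_moving] asks for. On the compact interval [[0, Q]] the
    profile [b] has a positive minimum and [F] a maximum, and [F / b] is the quantity bounded in
    [brakke_rhs_le_cst]. *)
Lemma brakke_rhs_gprofile_bounded {R : realType} {l : nat} (n : nat)
    (rho V s alpha beta K : R) (c : 'rV[R]_l) :
  0 <= rho ->
  (forall q, 0 <= q <= 2 * (rho + quad 0 c) -> 0 < alpha + beta * q) ->
  exists B : R, forall mu : {measure set (borel R l) -> \bar R},
    (mu setT <= V%:E)%E -> mu [set x | rho < quad 0 x] = 0%E ->
    (brakke_rhs n K mu (bump_fun c (cutoff rho) (gprofile s alpha beta)) <= B%:E)%E.
Proof.
move=> rho0 ab0; set Q := 2 * _ in ab0.
have Q0 : 0 <= Q by rewrite mulr_ge0// addr_ge0// quad_ge0.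
have hb := gprofile_C1 s alpha beta.
set b := gprofile s alpha beta in hb *; set b' := gprofile s _ _ in hb.
have cb := has_C1_derivative_continuous hb.
have b0 q : 0 <= q <= Q -> 0 < b q.
  by move=> qQ; rewrite /b /gprofile mulr_gt0 ?expR_gt0 ?ab0.
have [qm qmQ qmP] := EVT_min Q0 (continuous_subspaceT cb).
pose F q := 4 * b' q ^+ 2 * q + K ^+ 2 * b q ^+ 2.
have cF : continuous F.
  have [_ cb'] := hb.
  move=> q; apply: (@cvgD _ _ _ _ _ (fun q => 4 * b' q ^+ 2 * q) (fun q => K ^+ 2 *
      b q ^+ 2)).
    apply: (@cvgM _ _ _ _ (fun q => 4 * b' q ^+ 2) (fun q => q)); last exact: cvg_id.
    apply: (@cvgM _ _ _ _ (fun q => 4) (fun q => b' q ^+ 2)); first exact: cvg_cst.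
    exact: cvgM (cb' q) (cb' q).
  apply: (@cvgM _ _ _ _ (fun q => K ^+ 2) (fun q => b q ^+ 2)); first exact: cvg_cst.
  exact: cvgM (cb q) (cb q).
have [qM qMQ qMP] := EVT_max Q0 (continuous_subspaceT cF).
have F0 q : 0 <= q -> 0 <= F q.
  move=> q0; apply: addr_ge0; last exact: mulr_ge0 (sqr_ge0 _) (sqr_ge0 _).
  exact: mulr_ge0 (mulr_ge0 (ler0n _ 4) (sqr_ge0 _)) q0.
have bm : 0 < b qm by apply: b0; move: qmQ; rewrite in_itv.
have FM : 0 <= F qM by apply: F0; move: qMQ; rewrite in_itv/= => /andP[].
exists (F qM / b qm * V) => mu muV mu0.
have ball x : quad 0 x <= rho -> 0 <= quad c x <= Q.
  by move=> xrho; rewrite quad_ge0/=; exact: quad_le_ball.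
apply: (brakke_rhs_le_cst _ _ _ _ muV mu0 hb); first by rewrite divr_ge0// ltW.
  by move=> x /ball; exact: b0.
move=> x /ball qQ; have bq := b0 _ qQ.
rewrite (_ : _ + _ = F (quad c x) / b (quad c x)); last first.
  by rewrite /F; field; rewrite gt_eqF.
have qI : quad c x \in `[0, Q] by rewrite in_itv.
apply: ler_pM.
- by rewrite F0// quad_ge0.
- by rewrite invr_ge0 ltW.
- exact: qMP.
- by rewrite lef_pV2 ?posrE// qmP.
Qed.

Section gaussian_flow.
Context {R : realType} {l : nat} (n : nat) (c : 'rV[R]_l).

Definition garea (mu : {measure set (borel R l) -> \bar R}) (s : R) : R :=
  gauss_cst n s * \int[mu]_x gauss c s x.

Context {K K' T0 V rho a b : R} {I : set R}.
Context {mu : R -> {measure set (borel R l) -> \bar R}}.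
Hypotheses (abI : forall v, a <= v <= b -> I v)
  (muV : forall v, a <= v <= b -> (mu v setT <= V%:E)%E)
  (mu_rho : forall v, a <= v <= b -> mu v [set x | rho < quad 0 x] = 0%E)
  (rho0 : 0 <= rho) (bT0 : b < T0) (KK : K <= K') (K0 : 0 <= K')
  (flow : almost_brakke_flow n K I mu).

(** The kernel focuses at time [T0], so its scale at time [v] is [T0 - v]. The cutoff gives compact
    support and is invisible to the measures on [[a, b]]. *)
Definition cut_area (v : R) : R :=
  \int[mu v]_x bump_fun c (cutoff rho) (gprofile (T0 - v) (gauss_cst n (T0 - v)) 0) x.

Lemma cut_areaE v : a <= v <= b -> cut_area v = garea (mu v) (T0 - v).
Proof.
move=> vab; have v0 : 0 < T0 - v by case/andP: vab => _ vb;
    rewrite subr_gt0 (le_lt_trans vb).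
have vV := muV v vab; have vrho := mu_rho v vab.
rewrite /garea -RintegralZl//; last by apply: integrable_gauss vV _ _.
rewrite /cut_area /Rintegral; congr fine; apply: ae_eq_integral => //.
- by apply/measurable_EFinP; exact: measurable_bump (cutoff_C1 rho) (gprofile_C1 _ _ _).
- by apply/measurable_EFinP; apply: measurable_funM => //; exact: measurable_gauss.
- apply: ae_imp (ae_quad_le rho vrho) => x xrho _.
  by rewrite bump_cutoff// /gprofile mul0r addr0.
Qed.

(** Test functions must be nonnegative everywhere, hence the sign condition up to [rho + 1], where
    the cutoff vanishes, and not only up to [rho]. *)
Lemma flow_dini_le (s alpha beta r : R) u : a <= u <= b ->
  (forall x, quad 0 x <= rho + 1 -> 0 <= alpha + beta * quad c x) ->
  (brakke_rhs n K (mu u) (bump_fun c (cutoff rho) (gprofile s alpha beta)) <= r%:E)%E ->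
  dini_le a b (fun v => \int[mu v]_x bump_fun c (cutoff rho) (gprofile s alpha
      beta) x) u r.
Proof.
move=> uab ab0 rhs_r; apply: upper_derivative_dini_le abI _.
apply: le_trans rhs_r; case: flow => _ _; apply.
- exact: Ck_bump (cutoff_C1 rho) (gprofile_C1 _ _ _).
- apply: (@compactly_supported_of_quad _ _ _ _ (rho + 1)) => x rhox.
  by rewrite /bump_fun cutoff0 ?(ltW rhox)// mul0r.
- move=> x; rewrite /bump_fun; case: (lerP (quad 0 x) (rho + 1)) => xrho.
    by rewrite mulr_ge0 ?cutoff_ge0// mulr_ge0 ?expR_ge0// ab0.
  by rewrite cutoff0 ?(ltW xrho)// mul0r.
- exact: abI.
Qed.

(** Here [p] and [q] integrate the kernel frozen at time [u] and its time derivative. The motion of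
    the kernel adds [q u], which cancels the integral subtracted in [brakke_rhs_gaussian]. *)
Lemma cut_area_dini_le u : a <= u <= b ->
  dini_le a b cut_area u (K' ^+ 2 / 4 * garea (mu u) (T0 - u)
    + K' * 2 `^ (n%:R / 2) / Num.sqrt (T0 - u) * garea (mu u) (2 * (T0 - u))).
Proof.
move=> uab; set s := T0 - u; have s0 : 0 < s.
  by case/andP: uab => _ ub; rewrite subr_gt0 (le_lt_trans ub).
set kappa := gauss_cst n s; have kappa0 : 0 < kappa by exact: gauss_cst_gt0.
set k1 := kappa * (n%:R / (2 * s)); set k2 := - (kappa / (4 * s ^+ 2)).
pose p v := \int[mu v]_x bump_fun c (cutoff rho) (gprofile s kappa 0) x.
pose q v := \int[mu v]_x bump_fun c (cutoff rho) (gprofile s k1 k2) x.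
pose Q := 2 * (rho + 1 + quad 0 c).
have Q0 : 0 <= Q by rewrite mulr_ge0// !addr_ge0// quad_ge0.
(* The first two terms dominate the time derivative relative to the kernel where |x|^2 <= [rho + 1];
   the 1 makes C Phi + psi and C Phi - psi strictly positive there. *)
pose C := n%:R / (2 * s) + Q / (4 * s ^+ 2) + 1.
have n0 : 0 <= n%:R / (2 * s) by rewrite divr_ge0// mulr_ge0// ltW.
have q40 : 0 < 4 * s ^+ 2 by rewrite mulr_gt0// exprn_gt0.
have C0 : 0 <= C by rewrite !addr_ge0// divr_ge0// ltW.
have iB v (al be : R) : a <= v <= b ->
    (mu v).-integrable setT (EFin \o bump_fun c (cutoff rho) (gprofile s al be)).
  by move=> vab; exact: integrable_bump_gprofile (muV v vab) (mu_rho v vab) _ _ _ s0.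
have lin (e : R) v : a <= v <= b -> C * p v + e * q v =
    \int[mu v]_x bump_fun c (cutoff rho) (gprofile s (C * kappa + e * k1) (e * k2)) x.
  move=> vab; rewrite -RintegralZl ?iB// -RintegralZl ?iB// -RintegralD//.
  - by apply: eq_Rintegral => x _; rewrite /bump_fun /gprofile; ring.
  - by apply: integrable_EFinZ; exact: iB.
  - by apply: integrable_EFinZ; exact: iB.
have pos (e : R) r : -1 <= e <= 1 -> 0 <= r <= Q -> 0 < C * kappa + e * k1 + e * k2 * r.
  move=> /andP[e1 e2] /andP[r0 rQ].
  rewrite (_ : _ + _ = kappa * (C + e * (n%:R / (2 * s)) - e * (r / (4 * s ^+
      2)))); last first.
    by rewrite /k1 /k2; ring.
  rewrite mulr_gt0// /C.
  have : r / (4 * s ^+ 2) <= Q / (4 * s ^+ 2) by rewrite ler_wpM2r// invr_ge0 ltW.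
  have : 0 <= r / (4 * s ^+ 2) by rewrite divr_ge0// ltW.
  nra.
have Qball x : quad 0 x <= rho + 1 -> 0 <= quad c x <= Q.
  by move=> xrho; rewrite quad_ge0/=; exact: quad_le_ball.
have Dq (e : R) : -1 <= e <= 1 ->
    exists B, dini_le a b (fun v => C * p v + e * q v) u B.
  move=> e1.
  have [||B BP] := @brakke_rhs_gprofile_bounded R l n rho V s (C * kappa + e * k1)
      (e * k2) K c.
  - exact: rho0.
  - by move=> r /andP[r0 rQ]; apply: pos => //; rewrite r0 /Q; lra.
  exists B => e' e'0.
  have [||d d0 dP] := @flow_dini_le s (C * kappa + e * k1) (e * k2) B u uab _ _ e' e'0.
  - by move=> x /Qball xQ; rewrite ltW// pos.
  - exact: BP (muV u uab) (mu_rho u uab).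
  exists d => // h h0 hd hab; rewrite !lin//; exact: dP.
have [B1 D1] := Dq 1 ltac:(lra); have [B2 D2] := Dq (-1) ltac:(lra).
pose B := Num.max B1 B2.
have mono f r r' : r <= r' -> dini_le a b f u r -> dini_le a b f u r'.
  move=> rr D e e0; have [d d0 dP] := D e e0; exists d => // h h0 hd hab.
  by apply: le_trans (dP h h0 hd hab) _; lra.
rewrite (_ : _ + _ = (K' ^+ 2 / 4 * garea (mu u) s
    + K' * 2 `^ (n%:R / 2) / Num.sqrt s * garea (mu u) (2 * s) - q u) + q u);
        last by ring.
apply: (@dini_le_moving _ a b cut_area p q u _ C B C0) => //.
- apply: flow_dini_le => //; first by move=> x _; rewrite mul0r addr0 ltW.
  apply: le_trans (brakke_rhs_gaussian n rho V c (muV u uab) (mu_rho u uab) s kappa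
      K K' s0 (ltW kappa0) KK K0) _.
  rewrite lee_fin -/k1 -/k2 -/(q u) lerD2r /garea -/kappa.
  rewrite -lerBrDl (_ : _ - _ = kappa * K' / Num.sqrt s * \int[mu u]_x gauss c (2 *
      s) x); first by [].
  by rewrite /kappa (gauss_cst_double n s s0); ring.
- apply: mono (_ : B1 <= _) _; first by rewrite le_max lexx.
  by move: D1; under [fun v => _ + 1 * _]eq_fun do rewrite mul1r.
- apply: mono (_ : B2 <= _) _; first by rewrite le_max lexx orbT.
  by move: D2; under [fun v => _ + -1 * _]eq_fun do rewrite mulN1r.
(* The expansion is uniform on the ball, and integrating its error costs a factor of at most the
   mass [V]; hence the tolerance [e / (|V| + 1)]. *)
- move=> e e0; have uT : u < T0 by rewrite -subr_gt0.
  have e'0 : 0 < e / (`|V| + 1) by rewrite divr_gt0// ltr_wpDl.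
  have [d d0 dP] := gprofile_time_expansion n T0 u Q _ uT Q0 e'0.
  exists d => // h hd vab; set v := u + h in vab *.
  have vT : v < T0 by case/andP: vab => _ vb; exact: le_lt_trans bT0.
  have vV := muV v vab; have vrho := mu_rho v vab.
  pose phiv := bump_fun c (cutoff rho) (gprofile (T0 - v) (gauss_cst n (T0 - v)) 0).
  pose phi := bump_fun c (cutoff rho) (gprofile s kappa 0).
  pose psi := bump_fun c (cutoff rho) (gprofile s k1 k2).
  have i1 : (mu v).-integrable setT (EFin \o phiv).
    by apply: integrable_bump_gprofile vV vrho _ _ _ _; rewrite subr_gt0.
  have i2 := iB v kappa 0 vab; have i3 := integrable_EFinZ h _ (iB v k1 k2 vab).
  have i4 := integrable_EFinB _ _ i1 i2; have i5 := integrable_EFinB _ _ i4 i3.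
  rewrite -RintegralZl ?iB// -RintegralB// -RintegralB//.
  apply: le_trans (le_normr_Rintegral measurableT i5) _.
  pose N := e / (`|V| + 1) * `|h|.
  apply: (@le_trans _ _ (\int[mu v]_x N)).
    apply: ae_le_Rintegral.
    - exact: integrable_norm.
    - apply: (ae_bounded_integrable _ `|N|); [exact: mass_lty vV | by [] | exact: aeW].
    - apply: ae_imp (ae_quad_le rho vrho) => x xrho.
      have xrho1 : quad 0 x <= rho + 1 by apply: le_trans xrho _; rewrite lerDl.
      have := dP h hd vT (quad c x) (Qball x xrho1).
      by rewrite /phiv !bump_cutoff.
  rewrite Rintegral_cst// /N mulrAC -[leRHS]mulr1 -mulrA.
  rewrite [leLHS](_ : _ = e * `|h| * (fine (mu v setT) / (`|V| + 1))); last by ring.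
  rewrite ler_wpM2l ?mulr_ge0 ?(ltW e0)// ler_pdivrMr ?mul1r ?ltr_wpDl//.
  have : fine (mu v setT) <= V.
    have fin : mu v setT \is a fin_num.
      by rewrite ge0_fin_numE ?measure_ge0//; exact: mass_lty vV.
    by rewrite -lee_fin fineK.
  by move=> /le_trans; apply; rewrite (le_trans (ler_norm V))// lerDl.
Qed.

End gaussian_flow.

(** * Integration in time and absorption of the error *)

Section entropy_growth.
Context {R : realType} {l : nat} (n : nat).

(* The integral of K^2 / 4 + 2^(n/2) K / sqrt r over a time interval of
   length [r]. *)
Definition growth (K r : R) : R :=
  K ^+ 2 / 4 * r + 2 * (K * 2 `^ (n%:R / 2)) * Num.sqrt r.

(** [L] has to bound the areas at the doubled scale too, since the term with |y| was estimated by
    the kernel at that scale. [G] is the explicit primitive of the resulting rate [g]. *)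
Lemma garea_growth {K K' T0 V rho a b L : R} {I : set R} (c : 'rV[R]_l)
    {mu : R -> {measure set (borel R l) -> \bar R}} :
  (forall v, a <= v <= b -> I v) ->
  (forall v, a <= v <= b -> (mu v setT <= V%:E)%E) ->
  (forall v, a <= v <= b -> mu v [set x | rho < quad 0 x] = 0%E) ->
  0 <= rho -> a <= b -> b < T0 -> K <= K' -> 0 <= K' -> 0 <= L ->
  almost_brakke_flow n K I mu ->
  (forall v, a <= v <= b -> garea n c (mu v) (T0 - v) <= L) ->
  (forall v, a <= v <= b -> garea n c (mu v) (2 * (T0 - v)) <= L) ->
  garea n c (mu b) (T0 - b) <= garea n c (mu a) (T0 - a) + L * growth K' (b - a).
Proof.
move=> abI muV mu_rho rho0 ab bT0 KK K0 L0 flow L1 L2.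
pose A : R := 2 `^ (n%:R / 2); have A0 : 0 <= A by exact: powR_ge0.
pose g v := L * (K' ^+ 2 / 4 + K' * A / Num.sqrt (T0 - v)).
pose G (v : R) := L * (K' ^+ 2 / 4) * v - 2 * L * (K' * A) * Num.sqrt (T0 - v).
have gG u : a <= u <= b -> is_derive u 1 G (g u).
  move=> /andP[_ ub]; have uT : 0 < T0 - u by rewrite subr_gt0 (le_lt_trans ub).
  have ds : is_derive u 1 (fun v : R => T0 - v) (- 1).
    by rewrite -[X in is_derive _ _ _ X]sub0r; exact: is_deriveB.
  have d1 := is_deriveZ (2 * L * (K' * A)) (@is_derive1_comp _ Num.sqrt (fun v : R
      => T0 - v) u _ _ (is_derive1_sqrt uT) ds).
  have d2 := is_deriveZ (L * (K' ^+ 2 / 4)) (is_derive_id u (1 : R)).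
  have d3 := is_deriveB d2 d1.
  suff <- : (L * (K' ^+ 2 / 4)) *: 1 - (2 * L * (K' * A)) *: ((2 * Num.sqrt (T0 -
      u))^-1 * - 1) = g u by exact: d3.
  by rewrite /g /GRing.scale/=; field; rewrite gt_eqF// sqrtr_gt0.
have fD u : a <= u <= b -> dini_le a b (cut_area n c (T0 := T0) (rho := rho) (mu :=
    mu)) u (g u).
  move=> uab e e0.
  have [d d0 dP] := cut_area_dini_le n c abI muV mu_rho rho0 bT0 KK K0 flow u uab e e0.
  exists d => // h h0 hd hab; apply: le_trans (dP h h0 hd hab) _; rewrite lerD2r.
  rewrite /g [leRHS]mulrDr; apply: lerD.
    by rewrite mulrC ler_wpM2r ?L1// mulr_ge0 ?sqr_ge0.
  by rewrite mulrC ler_wpM2r ?L2// !mulr_ge0 ?invr_ge0 ?sqrtr_ge0.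
have aab : a <= a <= b by rewrite lexx ab.
have bab : a <= b <= b by rewrite lexx ab.
have := dini_le_integrate g ab gG fD.
rewrite (cut_areaE n c muV mu_rho bT0 _ aab) (cut_areaE n c muV mu_rho bT0 _ bab).
rewrite lerBlDl => /le_trans; apply; rewrite lerD2l /G /growth -/A.
(* Subadditivity of the square root makes the bound depend on [b - a] only, not on [T0]. *)
have sq : Num.sqrt (T0 - a) <= Num.sqrt (T0 - b) + Num.sqrt (b - a).
  rewrite -(ler_pXn2r (ltn0Sn 1)) ?nnegrE ?addr_ge0 ?sqrtr_ge0//.
  rewrite sqrrD !sqr_sqrtr ?subr_ge0 ?(ltW bT0)//; last exact: le_trans ab (ltW bT0).
  have := mulr_ge0 (sqrtr_ge0 (T0 - b)) (sqrtr_ge0 (b - a)); rewrite mulr2n; lra.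
have LKA : 0 <= 2 * L * (K' * A) by rewrite !mulr_ge0.
have := ler_wpM2l LKA sq; lra.
Qed.

Lemma gaussian_areaE {V : R} {mu : {measure set (borel R l) -> \bar R}} c s :
  (mu setT <= V%:E)%E -> 0 < s -> gaussian_area n mu c s = (garea n c mu s)%:E.
Proof.
move=> muV s0; rewrite /gaussian_area /garea EFinM; congr (_ * _)%E.
rewrite -EFin_Rintegral; last exact: integrable_gauss muV _ s0.
by apply: eq_integral => x _; rewrite sqr_enorm.
Qed.

Lemma garea_ge0 (mu : {measure set (borel R l) -> \bar R}) c s : 0 < s -> 0 <=
    garea n c mu s.
Proof.
move=> s0; rewrite mulr_ge0 ?(ltW (gauss_cst_gt0 _ _ s0))//.
by apply: Rintegral_ge0 => x _; exact: expR_ge0.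
Qed.

Lemma garea_le_mass {V : R} {mu : {measure set (borel R l) -> \bar R}} c eta s :
  (mu setT <= V%:E)%E -> 0 < eta -> eta <= s -> garea n c mu s <= gauss_cst n eta * V.
Proof.
move=> muV eta0 etas; have s0 := lt_le_trans eta0 etas.
have ig := integrable_gauss V c muV s s0.
apply: ler_pM.
- exact: ltW (gauss_cst_gt0 _ _ s0).
- by apply: Rintegral_ge0 => x _; exact: expR_ge0.
- exact: gauss_cst_le.
rewrite -lee_fin -EFin_Rintegral//.
apply: le_trans (_ : \int[mu]_x 1%:E <= _)%E.
  apply: ge0_le_integral => //; first by move=> x _; rewrite lee_fin expR_ge0.
  - exact: measurable_int ig.
  - by move=> x _; rewrite lee_fin gauss_le1.
by rewrite integral_cst// mul1e.
Qed.

(** The growth estimate involves [L], an upper bound for the very quantities being estimated. Since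
    [L] is finite by the mass bound and its coefficient is at most 1/2, it can be absorbed. *)
Lemma garea_le_entropy_growth {K K' V rho a b lambda : R} {I : set R}
    {mu : R -> {measure set (borel R l) -> \bar R}} :
  (forall v, a <= v <= b -> I v) ->
  (forall v, a <= v <= b -> (mu v setT <= V%:E)%E) ->
  (forall v, a <= v <= b -> mu v [set x | rho < quad 0 x] = 0%E) ->
  0 <= rho -> a <= b -> K <= K' -> 0 <= K' ->
  almost_brakke_flow n K I mu ->
  (forall c s, 0 < s -> garea n c (mu a) s <= lambda) ->
  growth K' (b - a) <= 1 / 2 ->
  forall c s, 0 < s -> garea n c (mu b) s <= lambda + 2 * lambda * growth K' (b - a).
Proof.
move=> abI muV mu_rho rho0 ab KK K0 flow ent gr c s s0.
have bab : a <= b <= b by rewrite lexx ab.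
(* All times and centres are included, but only scales at least [s]: this keeps [S] bounded and
   closed under the passage to earlier times and to doubled scales. *)
pose S := [set r : R | exists v c' s', [/\ a <= v <= b, s <= s' & r = garea n c'
    (mu v) s']].
have Sb : S (garea n c (mu b) s) by exists b, c, s.
have Sub : ubound S (gauss_cst n s * V).
  by move=> _ [v [c' [s' [vab ss' ->]]]]; exact: garea_le_mass (muV v vab) s0 ss'.
have hS : has_sup S by split; [exists (garea n c (mu b) s) | exists (gauss_cst n s
    * V)].
set L := sup S.
have SL r : S r -> r <= L by move=> Sr; apply: ub_le_sup => //;
    exists (gauss_cst n s * V).
have L0 : 0 <= L by apply: le_trans (SL _ Sb); exact: garea_ge0.
have gr_mono v : a <= v <= b -> growth K' (v - a) <= growth K' (b - a).
  move=> /andP[av vb]; have vaba : v - a <= b - a by rewrite lerD2r.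
  apply: lerD; apply: ler_wpM2l => //; [ | | exact: ler_wsqrtr].
    by rewrite mulr_ge0 ?sqr_ge0.
  by rewrite !mulr_ge0 ?powR_ge0.
have main r : S r -> r <= lambda + L * growth K' (b - a).
  move=> [v [c' [s' [vab ss' ->]]]]; have s'0 := lt_le_trans s0 ss'.
  have /andP[av vb] := vab.
  have sub u : a <= u <= v -> a <= u <= b.
    by move=> /andP[-> uv]; exact: le_trans vb.
  (* With focal time [v + s'] the scale is [s'] at time [v] and larger before, so it never drops
     below [s]. *)
  have vs : v < v + s' by rewrite ltrDl.
  have Ls u : a <= u <= v -> s <= v + s' - u.
    by move=> /andP[_ uv]; rewrite addrAC (le_trans ss')// lerDr subr_ge0.
  have := @garea_growth K K' (v + s') V rho a v L I c' mu
    (fun u h => abI u (sub u h)) (fun u h => muV u (sub u h))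
    (fun u h => mu_rho u (sub u h)) rho0 av vs KK K0 L0 flow.
  rewrite addrAC subrr add0r => H; apply: le_trans (H _ _) _.
  - by move=> u uav; apply: SL; exists u, c', (v + s' - u); split; rewrite ?sub ?Ls.
  - move=> u uav; apply: SL; exists u, c', (2 * (v + s' - u)); split; rewrite ?sub//.
    apply: le_trans (Ls u uav) _; rewrite ler_peMl ?ler1n//.
    by rewrite (le_trans (ltW s0))// Ls.
  - apply: lerD; first by apply: ent; rewrite (lt_le_trans s0)// Ls// lexx.
    by rewrite ler_wpM2l// gr_mono.
have LL : L <= lambda + L * growth K' (b - a).
  by apply: ge_sup => //; exists (garea n c (mu b) s).
have gr0 : 0 <= growth K' (b - a).
  by rewrite addr_ge0 ?mulr_ge0 ?sqr_ge0 ?powR_ge0 ?sqrtr_ge0 ?subr_ge0.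
(* From L <= lambda + L / 2; the estimate is then applied once more with this bound on [L]. *)
have := ler_wpM2l L0 gr => L2; have L3 : L <= 2 * lambda by lra.
apply: le_trans (main _ Sb) _; rewrite lerD2l; exact: ler_wpM2r.
Qed.

End entropy_growth.

(** * Choice of [delta] and the entropy estimate *)

Theorem proposition4p5 (R : realType) (n l : nat) (Lambda tau eps0 : R)
    (htau : 0 < tau) (heps0 : 0 < eps0) :
  exists delta : R, 0 < delta /\
    forall (K : R) (T : \bar R) (M : R -> set 'rV[R]_l)
           (mu : R -> {measure set (borel R l) -> \bar R}) (V : R),
      let I := [set t : R | 0 <= t /\ (t%:E < T)%E] in
      smooth_compact_flow n I M ->
      (forall t, I t -> area_measure n (M t) (mu t)) ->
      (forall t, I t -> (mu t setT <= V%:E)%E) ->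
      almost_brakke_flow n K I mu ->
      K < delta ->
      forall t s : R, 0 <= t -> t < s -> (s%:E < T)%E -> s - t < tau ->
        (entropy n (mu t) <= Lambda%:E)%E ->
        (entropy n (mu s) < entropy n (mu t) + eps0%:E)%E.
Proof.
pose A : R := 2 `^ (n%:R / 2).
have A0 : 0 <= A by exact: powR_ge0.
(* The target for the growth: 1/2 permits the absorption, and the second bound makes 2 lambda m at
   most [eps0 / 2] for every entropy value lambda <= [Lambda]. *)
pose m := Num.min (1 / 2) (eps0 / (4 * (`|Lambda| + 1))).
have Lam0 : 0 < 4 * (`|Lambda| + 1) by rewrite mulr_gt0// ltr_wpDl.
have m0 : 0 < m by rewrite lt_min !divr_gt0.
(* For [delta <= 1] the square of [delta] is at most [delta], so the growth over a time less than
   [tau] is at most [delta * c]. *)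
pose c := tau / 4 + 2 * A * Num.sqrt tau + 1.
have c0 : 0 < c by have := mulr_ge0 A0 (sqrtr_ge0 tau); rewrite /c; lra.
pose delta := Num.min 1 (m / c).
have delta0 : 0 < delta by rewrite lt_min ltr01 divr_gt0.
exists delta; split => // K T M mu V I smooth area muV flow Kd t s t0 ts sT st tent.
have tsI v : t <= v <= s -> I v.
  move=> /andP[tv vs]; split; first exact: le_trans tv.
  by apply: le_lt_trans sT; rewrite lee_fin.
have tts : t <= t <= s by rewrite lexx ltW.
have sts : t <= s <= s by rewrite lexx ltW.
have [rho rho0 mu_rho] := smooth_compact_flow_support smooth area tsI (ltW ts).
have growth_le : growth n delta (s - t) <= m.
  have d1 : delta <= 1 by rewrite ge_min lexx.
  have d2 : delta * c <= m by rewrite -ler_pdivlMr// ge_min lexx orbT.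
  apply: le_trans d2; rewrite /growth /c -/A.
  have dd : delta ^+ 2 <= delta by rewrite expr2 ler_piMl// ltW.
  have H1 : delta ^+ 2 / 4 * (s - t) <= delta / 4 * tau.
    apply: ler_pM; [by rewrite divr_ge0 ?sqr_ge0 | by rewrite subr_ge0 ltW | |
        exact: ltW].
    by rewrite ler_wpM2r ?invr_ge0.
  have H2 : Num.sqrt (s - t) <= Num.sqrt tau by rewrite ler_wsqrtr// ltW.
  have H3 := ler_wpM2l (mulr_ge0 (ler0n _ 2) (mulr_ge0 (ltW delta0) A0)) H2.
  lra.
have ent_ge (u : R) c' r : t <= u <= s -> 0 < r -> ((garea n c' (mu u) r)%:E <=
    entropy n (mu u))%E.
  move=> uts r0; apply: ereal_sup_ubound; exists (c', r) => //=.
  exact: gaussian_areaE (muV u (tsI u uts)) r0.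
have lam0 : (0 <= entropy n (mu t))%E.
  by apply: le_trans (ent_ge t 0 1 tts ltr01); rewrite lee_fin garea_ge0.
have lamfin : entropy n (mu t) \is a fin_num.
  by rewrite ge0_fin_numE// (le_lt_trans tent)// ltry.
rewrite -(fineK lamfin) in tent lam0 *; set lambda := fine _ in tent lam0 *.
rewrite !lee_fin in tent lam0.
have ent c' r : 0 < r -> garea n c' (mu t) r <= lambda.
  by move=> r0; rewrite -lee_fin fineK//; exact: ent_ge.
have gr := @garea_le_entropy_growth R l n K delta V rho t s lambda I mu tsI
  (fun v h => muV v (tsI v h)) mu_rho rho0 (ltW ts) (ltW Kd) (ltW delta0) flow ent.
(* A supremum only yields a weak inequality; the spare [eps0 / 2] makes it strict. *)
apply: (@le_lt_trans _ _ (lambda + eps0 / 2)%:E); last first.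
  by rewrite -EFinD lte_fin; lra.
apply: ge_ereal_sup => _ [[c' r] /= r0 <-].
rewrite (gaussian_areaE n c' r (muV s (tsI s sts)) r0) lee_fin.
apply: le_trans (gr _ c' r r0) _; first by apply: le_trans growth_le _;
    rewrite ge_min lexx.
rewrite lerD2l.
have me : m * (4 * (`|Lambda| + 1)) <= eps0 by rewrite -ler_pdivlMr// ge_min lexx orbT.
have L1 : lambda <= `|Lambda| + 1.
  by apply: le_trans tent _; apply: le_trans (ler_norm _) _; rewrite lerDl.
have H1 : 2 * lambda * growth n delta (s - t) <= 2 * lambda * m.
  by rewrite ler_wpM2l// mulr_ge0.
have H2 := ler_wpM2r (ltW m0) L1.
lra.
Qed.
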